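(* Let $\mathbb{K}$ be an arbitrary field and consider the $\mathbb{Z}_2$-grading $\Gamma(1,1)$ on $\mathrm{UT}_3^{(-)}(\mathbb{K})$. Then $\mathrm{Id}_{\mathbb{Z}_2}(\mathrm{UT}_3^{(-)},\Gamma(1,1))$ is generated, as a $T_{\mathbb{Z}_2}$-ideal, by (i) $[z_1,z_2,z_3]$; (ii) $[y_1,y_2,z]$; (iii) $\mathrm{Id}(\mathrm{UT}_2^{(-)})\cap\mathcal{L}(Y)$; and, in addition, if $\mathbb{K}$ is finite containing $q$ elements, (iv) $[z,y^{(q)}]-[z,y]$. Moreover, a basis of the relatively free algebra $\mathcal{L}(Z\cup Y)$ modulo $\mathrm{Id}_{\mathbb{Z}_2}(\mathrm{UT}_3^{(-)},\Gamma(1,1))$ is given by a basis of the relatively free algebra of $\mathrm{UT}_2(\mathbb{K})^{(-)}$ in the variables $Y$ together with the polynomials $$[z,y_1^{(p_1)},\ldots,y_r^{(p_r)}],\qquad [[z_i,y_1^{(p_1)},\ldots,y_r^{(p_r)}],[z_j,y_1^{(q_1)},\ldots,y_r^{(q_r)}]],$$ where $z$ ranges over $Z$, $i\le j$, $r\ge0$ and $0\le p_\ell,q_\ell<|\mathbb{K}|$ for each $\ell\in\{1,\ldots,r\}$ (no upper bound if $\mathbb{K}$ is infinite), and where moreover, if $i=j$, then $(p_1,\ldots,p_r)<_l(q_1,\ldots,q_r)$, with $<_l$ the lexicographic order on $\mathbb{N}_0^r$.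
   Context: $\mathrm{UT}_n^{(-)}=\mathrm{UT}_n(\mathbb{K})^{(-)}$ is the Lie algebra of upper triangular $n\times n$ matrices over $\mathbb{K}$ with bracket $[a,b]=ab-ba$; $e_{ij}$ are matrix units. $\mathbb{Z}_2=\{0,1\}$ is the cyclic group of order 2 in additive notation, and $\Gamma(1,1)$ is the $\mathbb{Z}_2$-grading on $\mathrm{UT}_3^{(-)}$ with $\deg e_{ii}=\deg e_{13}=0$ and $\deg e_{12}=\deg e_{23}=1$. $\mathcal{L}(Z\cup Y)=\mathcal{L}(X^{\mathbb{Z}_2})$ is the free $\mathbb{Z}_2$-graded Lie algebra over $\mathbb{K}$ freely generated by $Y=\{y_i\mid i\in\mathbb{N}\}$ (degree $0$) and $Z=\{z_i\mid i\in\mathbb{N}\}$ (degree $1$); $y$ and $z$ without index denote a variable of $Y$, resp. $Z$; $\mathcal{L}(Y)$ is the free Lie algebra on $Y$. Commutators are left-normed, and $[x,y^{(m)}]=[x,y,\ldots,y]$ with $y$ repeated $m$ times. $\mathrm{Id}_{\mathbb{Z}_2}(\mathrm{UT}_3^{(-)},\Gamma)$ is the set of elements of $\mathcal{L}(Z\cup Y)$ that vanish under every graded homomorphism to $(\mathrm{UT}_3^{(-)},\Gamma)$. A $T_{\mathbb{Z}_2}$-ideal is an ideal of $\mathcal{L}(Z\cup Y)$ invariant under all graded endomorphisms. $\mathrm{Id}(\mathrm{UT}_2^{(-)})\cap\mathcal{L}(Y)$ is the ideal of ordinary Lie polynomial identities of $\mathrm{UT}_2(\mathbb{K})^{(-)}$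 in the variables $Y$; a basis of the relatively free algebra of $\mathrm{UT}_2(\mathbb{K})^{(-)}$ in the variables $Y$ is a set of elements of $\mathcal{L}(Y)$ whose images form a basis of $\mathcal{L}(Y)/(\mathrm{Id}(\mathrm{UT}_2^{(-)})\cap\mathcal{L}(Y))$. *)

(* Defs.v *)
From HB Require Import structures.
From mathcomp Require Import all_boot all_order all_algebra generic_quotient ring.
From mathcomp Require Import boolp classical_sets cardinality.

Set Implicit Arguments.
Unset Strict Implicit.
Unset Printing Implicit Defensive.

Import GRing.Theory.
Local Open Scope ring_scope.
Local Open Scope classical_set_scope.
Local Open Scope quotient_scope.

(* The alternating law [u, u] = 0 (rather than antisymmetry) is the correct
   axiom in characteristic 2. *)
HB.mixin Record Lmodule_isLieAlgebra (K : fieldType) L of GRing.Lmodule K L := {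
  lie_br : L -> L -> L;
  lie_brl : forall (a : K) (u v w : L),
    lie_br (a *: u + v) w = a *: lie_br u w + lie_br v w;
  lie_brr : forall (a : K) (u v w : L),
    lie_br w (a *: u + v) = a *: lie_br w u + lie_br w v;
  lie_brvv : forall u : L, lie_br u u = 0;
  lie_jacobi : forall u v w : L,
    lie_br (lie_br u v) w + lie_br (lie_br v w) u + lie_br (lie_br w u) v = 0
}.

#[short(type="lieAlgType")]
HB.structure Definition LieAlgebra (K : fieldType) :=
  { L of Lmodule_isLieAlgebra K L & GRing.Lmodule K L }.

Arguments lie_br {K s} u v.

(* [lcomm u [:: v1; ...; vm]] is the left-normed [u, v1, ..., vm]. *)
Definition lcomm (K : fieldType) (L : lieAlgType K) (u : L) (s : seq L) : L :=
  foldl lie_br u s.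

Definition lie_morphism (K : fieldType) (L M : lieAlgType K) (phi : L -> M) :=
  linear phi /\ {morph phi : u v / lie_br u v >-> lie_br u v}.

Definition lie_ideal (K : fieldType) (L : lieAlgType K) (I : set L) :=
  [/\ I 0,
      forall (a : K) u v, I u -> I v -> I (a *: u + v)
    & forall u v, I u -> I (lie_br u v) /\ I (lie_br v u)].

Section UpperTriangular.
Variables (K : fieldType) (n : nat).

Definition upper_mx : pred 'M[K]_n :=
  fun A => [forall i : 'I_n, forall j : 'I_n, (j < i)%N ==> (A i j == 0)].

Lemma upper_mxP (A : 'M[K]_n) :
  reflect (forall i j : 'I_n, (j < i)%N -> A i j = 0) (A \in upper_mx).
Proof.
apply: (iffP forallP) => [H i j ji | H i].
  by have /forallP/(_ j)/implyP/(_ ji)/eqP := H i.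
by apply/forallP => j; apply/implyP => ji; rewrite H.
Qed.

Lemma upper_mx_submod : GRing.submod_closed upper_mx.
Proof.
split=> [|a A B /upper_mxP hA /upper_mxP hB].
  by apply/upper_mxP => i j _; rewrite mxE.
by apply/upper_mxP => i j ji; rewrite !mxE hA // hB // mulr0 addr0.
Qed.

HB.instance Definition _ :=
  GRing.isSubmodClosed.Build K 'M[K]_n upper_mx upper_mx_submod.

Record UT := MkUT { ut_val :> 'M[K]_n; ut_valP : ut_val \in upper_mx }.

HB.instance Definition _ := [isSub for ut_val].
HB.instance Definition _ := [Choice of UT by <:].
HB.instance Definition _ := [SubChoice_isSubLmodule of UT by <:].

Lemma upper_mxM (A B : 'M[K]_n) :
  A \in upper_mx -> B \in upper_mx -> A *m B \in upper_mx.
Proof.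
move=> /upper_mxP hA /upper_mxP hB; apply/upper_mxP => i j ji.
rewrite mxE big1 // => k _; case: (ltnP k i) => ki; first by rewrite hA ?mul0r.
by rewrite hB ?mulr0 // (leq_trans ji).
Qed.

Lemma ut_br_subproof (A B : UT) : ut_val A *m B - ut_val B *m A \in upper_mx.
Proof. by rewrite rpredB // upper_mxM // ut_valP. Qed.

Definition ut_br (A B : UT) : UT := MkUT (ut_br_subproof A B).

Lemma ut_brl a (A B C : UT) :
  ut_br (a *: A + B) C = a *: ut_br A C + ut_br B C.
Proof.
apply: val_inj; rewrite /= mulmxDl mulmxDr.
by rewrite -?scalemxAl -?scalemxAr scalerBr opprD addrACA.
Qed.

Lemma ut_brr a (A B C : UT) :
  ut_br C (a *: A + B) = a *: ut_br C A + ut_br C B.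
Proof.
apply: val_inj; rewrite /= mulmxDl mulmxDr.
by rewrite -?scalemxAl -?scalemxAr scalerBr opprD addrACA.
Qed.

Lemma ut_brvv (A : UT) : ut_br A A = 0.
Proof. by apply: val_inj; rewrite /= subrr. Qed.

Lemma ut_jacobi (A B C : UT) :
  ut_br (ut_br A B) C + ut_br (ut_br B C) A + ut_br (ut_br C A) B = 0.
Proof.
apply: val_inj; rewrite /= !mulmxBl !mulmxBr !mulmxA.
by apply/matrixP => i j; rewrite !mxE; ring.
Qed.

HB.instance Definition _ :=
  Lmodule_isLieAlgebra.Build K UT ut_brl ut_brr ut_brvv ut_jacobi.

End UpperTriangular.

(* Lie words over [V], modulo the congruence generated by the axioms of Lie
   algebras over [K]. *)
Section FreeLie.
Variables (K : fieldType) (V : Type).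

Inductive lword :=
  | LVar of V
  | LZero
  | LAdd of lword & lword
  | LScale of K & lword
  | LBr of lword & lword.

Inductive lword_eqv : lword -> lword -> Prop :=
  | leqv_refl s : lword_eqv s s
  | leqv_sym s t : lword_eqv s t -> lword_eqv t s
  | leqv_trans s t r : lword_eqv s t -> lword_eqv t r -> lword_eqv s r
  | leqv_add s s' t t' : lword_eqv s s' -> lword_eqv t t' ->
      lword_eqv (LAdd s t) (LAdd s' t')
  | leqv_scale a s s' : lword_eqv s s' ->
      lword_eqv (LScale a s) (LScale a s')
  | leqv_br s s' t t' : lword_eqv s s' -> lword_eqv t t' ->
      lword_eqv (LBr s t) (LBr s' t')
  | leqv_addA s t r : lword_eqv (LAdd s (LAdd t r)) (LAdd (LAdd s t) r)
  | leqv_addC s t : lword_eqv (LAdd s t) (LAdd t s)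
  | leqv_add0 s : lword_eqv (LAdd LZero s) s
  | leqv_addN s : lword_eqv (LAdd (LScale (-1) s) s) LZero
  | leqv_scaleA a b s : lword_eqv (LScale a (LScale b s)) (LScale (a * b) s)
  | leqv_scale1 s : lword_eqv (LScale 1 s) s
  | leqv_scaleDr a s t :
      lword_eqv (LScale a (LAdd s t)) (LAdd (LScale a s) (LScale a t))
  | leqv_scaleDl s a b :
      lword_eqv (LScale (a + b) s) (LAdd (LScale a s) (LScale b s))
  | leqv_brl a s t r :
      lword_eqv (LBr (LAdd (LScale a s) t) r) (LAdd (LScale a (LBr s r)) (LBr t r))
  | leqv_brr a s t r :
      lword_eqv (LBr r (LAdd (LScale a s) t)) (LAdd (LScale a (LBr r s)) (LBr r t))
  | leqv_brvv s : lword_eqv (LBr s s) LZero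
  | leqv_jacobi s t r :
      lword_eqv (LAdd (LAdd (LBr (LBr s t) r) (LBr (LBr t r) s)) (LBr (LBr r s) t))
                LZero.

HB.instance Definition _ := gen_eqMixin lword.
HB.instance Definition _ := gen_choiceMixin lword.

Definition lword_eq : rel lword := fun s t => `[< lword_eqv s t >].

Lemma lword_eq_refl : reflexive lword_eq.
Proof. by move=> s; apply/asboolP/leqv_refl. Qed.

Lemma lword_eq_sym : symmetric lword_eq.
Proof. by move=> s t; apply/asboolP/asboolP => /leqv_sym. Qed.

Lemma lword_eq_trans : transitive lword_eq.
Proof.
by move=> t s r /asboolP st /asboolP tr; apply/asboolP/(leqv_trans st).
Qed.

Canonical lword_equiv :=
  EquivRel lword_eq lword_eq_refl lword_eq_sym lword_eq_trans.

Definition freeLie := {eq_quot lword_eq}.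

HB.instance Definition _ : EqQuotient lword lword_equiv freeLie :=
  EqQuotient.on freeLie.
HB.instance Definition _ := Choice.on freeLie.

Definition fl_class (s : lword) : freeLie := \pi_freeLie s.

Lemma fl_classP s t : lword_eqv s t <-> fl_class s = fl_class t.
Proof.
by split=> [st|/eqmodP/asboolP //]; apply/eqmodP/asboolP.
Qed.

Lemma fl_classK (u : freeLie) : fl_class (repr u) = u.
Proof. exact: reprK. Qed.

Lemma repr_class s : lword_eqv (repr (fl_class s)) s.
Proof. by apply/fl_classP; rewrite fl_classK. Qed.

Definition gen (x : V) : freeLie := fl_class (LVar x).

Definition fl_zero : freeLie := fl_class LZero.
Definition fl_add (u v : freeLie) := fl_class (LAdd (repr u) (repr v)).
Definition fl_opp (u : freeLie) := fl_class (LScale (-1) (repr u)).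
Definition fl_scale (a : K) (u : freeLie) := fl_class (LScale a (repr u)).
Definition fl_br (u v : freeLie) := fl_class (LBr (repr u) (repr v)).

Lemma fl_addE s t : fl_add (fl_class s) (fl_class t) = fl_class (LAdd s t).
Proof. by apply/fl_classP/leqv_add; apply: repr_class. Qed.

Lemma fl_scaleE a s : fl_scale a (fl_class s) = fl_class (LScale a s).
Proof. by apply/fl_classP/leqv_scale; apply: repr_class. Qed.

Lemma fl_oppE s : fl_opp (fl_class s) = fl_class (LScale (-1) s).
Proof. by apply/fl_classP/leqv_scale; apply: repr_class. Qed.

Lemma fl_brE s t : fl_br (fl_class s) (fl_class t) = fl_class (LBr s t).
Proof. by apply/fl_classP/leqv_br; apply: repr_class. Qed.

Definition flE := (fl_addE, fl_scaleE, fl_oppE, fl_brE).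

Lemma fl_addA : associative fl_add.
Proof.
move=> u v w; rewrite -[u]fl_classK -[v]fl_classK -[w]fl_classK !flE.
exact/fl_classP/leqv_addA.
Qed.

Lemma fl_addC : commutative fl_add.
Proof.
move=> u v; rewrite -[u]fl_classK -[v]fl_classK !flE.
exact/fl_classP/leqv_addC.
Qed.

Lemma fl_add0 : left_id fl_zero fl_add.
Proof.
by move=> u; rewrite -[u]fl_classK !flE; apply/fl_classP/leqv_add0.
Qed.

Lemma fl_addN : left_inverse fl_zero fl_opp fl_add.
Proof.
by move=> u; rewrite -[u]fl_classK !flE; apply/fl_classP/leqv_addN.
Qed.

HB.instance Definition _ :=
  GRing.isZmodule.Build freeLie fl_addA fl_addC fl_add0 fl_addN.

Lemma fl_scaleA a b u : fl_scale a (fl_scale b u) = fl_scale (a * b) u.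
Proof. by rewrite -[u]fl_classK !flE; apply/fl_classP/leqv_scaleA. Qed.

Lemma fl_scale1 : left_id 1 fl_scale.
Proof.
by move=> u; rewrite -[u]fl_classK !flE; apply/fl_classP/leqv_scale1.
Qed.

Lemma fl_scaleDr : right_distributive fl_scale +%R.
Proof.
move=> a u v; rewrite -[u]fl_classK -[v]fl_classK /GRing.add /= !flE.
exact/fl_classP/leqv_scaleDr.
Qed.

Lemma fl_scaleDl u : {morph fl_scale^~ u : a b / a + b}.
Proof.
move=> a b; rewrite -[u]fl_classK [in RHS]/GRing.add /= !flE.
exact/fl_classP/leqv_scaleDl.
Qed.

HB.instance Definition _ := GRing.Zmodule_isLmodule.Build K freeLie
  fl_scaleA fl_scale1 fl_scaleDr fl_scaleDl.

Lemma fl_brl a (u v w : freeLie) :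
  fl_br (a *: u + v) w = a *: fl_br u w + fl_br v w.
Proof.
rewrite -[u]fl_classK -[v]fl_classK -[w]fl_classK.
rewrite /GRing.add /GRing.scale /= !flE; exact/fl_classP/leqv_brl.
Qed.

Lemma fl_brr a (u v w : freeLie) :
  fl_br w (a *: u + v) = a *: fl_br w u + fl_br w v.
Proof.
rewrite -[u]fl_classK -[v]fl_classK -[w]fl_classK.
rewrite /GRing.add /GRing.scale /= !flE; exact/fl_classP/leqv_brr.
Qed.

Lemma fl_brvv (u : freeLie) : fl_br u u = 0.
Proof. by rewrite -[u]fl_classK !flE; apply/fl_classP/leqv_brvv. Qed.

Lemma fl_jacobi (u v w : freeLie) :
  fl_br (fl_br u v) w + fl_br (fl_br v w) u + fl_br (fl_br w u) v = 0.
Proof.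
rewrite -[u]fl_classK -[v]fl_classK -[w]fl_classK.
by rewrite /GRing.add /= !flE; apply/fl_classP/leqv_jacobi.
Qed.

HB.instance Definition _ :=
  Lmodule_isLieAlgebra.Build K freeLie fl_brl fl_brr fl_brvv fl_jacobi.

(* The universal property: [fl_lift h] is the unique morphism of Lie algebras
   with [gen x |-> h x]. *)
Section Lift.
Variables (L : lieAlgType K) (h : V -> L).

Fixpoint lword_eval (s : lword) : L :=
  match s with
  | LVar x => h x
  | LZero => 0
  | LAdd s t => lword_eval s + lword_eval t
  | LScale a s => a *: lword_eval s
  | LBr s t => lie_br (lword_eval s) (lword_eval t)
  end.

Lemma lword_eval_eqv s t : lword_eqv s t -> lword_eval s = lword_eval t.
Proof.
elim=> {s t} //=.
- by move=> s t r _ -> _ ->.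
- by move=> s s' t t' _ -> _ ->.
- by move=> a s s' _ ->.
- by move=> s s' t t' _ -> _ ->.
- by move=> s t r; rewrite addrA.
- by move=> s t; rewrite addrC.
- by move=> s; rewrite add0r.
- by move=> s; rewrite scaleN1r addNr.
- by move=> a b s; rewrite scalerA.
- by move=> s; rewrite scale1r.
- by move=> a s t; rewrite scalerDr.
- by move=> s a b; rewrite scalerDl.
- by move=> a s t r; rewrite lie_brl.
- by move=> a s t r; rewrite lie_brr.
- by move=> s; rewrite lie_brvv.
- by move=> s t r; rewrite lie_jacobi.
Qed.

Definition fl_lift (u : freeLie) : L := lword_eval (repr u).

Lemma fl_liftE s : fl_lift (fl_class s) = lword_eval s.
Proof. exact/lword_eval_eqv/repr_class. Qed.

Lemma fl_lift_gen x : fl_lift (gen x) = h x.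
Proof. exact: fl_liftE. Qed.

Lemma fl_lift_morphism : lie_morphism fl_lift.
Proof.
split=> [a u v|u v]; rewrite -[u]fl_classK -[v]fl_classK.
  by rewrite /GRing.add /GRing.scale /= !flE !fl_liftE.
by rewrite /lie_br /= !flE !fl_liftE.
Qed.

Lemma fl_lift_unique (phi : freeLie -> L) :
  lie_morphism phi -> (forall x, phi (gen x) = h x) -> phi =1 fl_lift.
Proof.
move=> [lin br] hg u; rewrite -[u]fl_classK fl_liftE.
have phi0 : phi 0 = 0.
  by have := lin (-1) 0 0; rewrite !scaleN1r !addNr.
elim: (repr u) => [x||s IHs t IHt|a s IHs|s IHs t IHt] //=.
- exact: hg.
- by rewrite -fl_addE -[fl_class s]scale1r lin IHs IHt scale1r.
- by rewrite -fl_scaleE -[fl_scale _ _]addr0 lin IHs phi0 addr0.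
- by rewrite -fl_brE br IHs IHt.
Qed.

End Lift.

(* The grading on the free Lie algebra induced by degrees of the variables:
   component [g] is the span of the Lie monomials of total degree [g]. *)
Inductive fl_comp (deg : V -> 'Z_2) : 'Z_2 -> set freeLie :=
  | fl_comp_gen x : fl_comp deg (deg x) (gen x)
  | fl_comp0 g : fl_comp deg g 0
  | fl_compP g (a : K) u v :
      fl_comp deg g u -> fl_comp deg g v -> fl_comp deg g (a *: u + v)
  | fl_comp_br g h u v :
      fl_comp deg g u -> fl_comp deg h v -> fl_comp deg (g + h) (lie_br u v).

End FreeLie.

Definition graded_morphism (K : fieldType) (L M : lieAlgType K)
    (gL : 'Z_2 -> set L) (gM : 'Z_2 -> set M) (phi : L -> M) :=
  lie_morphism phi /\ forall g u, gL g u -> gM g (phi u).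

Definition graded_Id (K : fieldType) (L M : lieAlgType K)
    (gL : 'Z_2 -> set L) (gM : 'Z_2 -> set M) : set L :=
  [set f | forall phi : L -> M, graded_morphism gL gM phi -> phi f = 0].

Definition T_ideal (K : fieldType) (L : lieAlgType K)
    (gL : 'Z_2 -> set L) (I : set L) :=
  lie_ideal I /\
  forall phi : L -> L, graded_morphism gL gL phi -> forall f, I f -> I (phi f).

(* The images of the elements of [B] are pairwise distinct and form a basis of
   the quotient of [L] by the subspace [I]. *)
Definition basis_mod (K : fieldType) (L : lmodType K) (I B : set L) :=
  (forall f : L, exists (s : seq L) (c : L -> K),
     [set` s] `<=` B /\ I (f - \sum_(u <- s) c u *: u)) /\
  (forall (s : seq L) (c : L -> K), uniq s -> [set` s] `<=` B ->
     I (\sum_(u <- s) c u *: u) -> forall u, u \in s -> c u = 0).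

(* Indices start at 0: y_1, y_2, ... are [Yvar 0], [Yvar 1], ... *)
Inductive gvar := Yvar of nat | Zvar of nat.

Definition gvar_deg (x : gvar) : 'Z_2 :=
  match x with Yvar _ => 0 | Zvar _ => 1 end.

Section Gamma11.
Variable K : fieldType.

Local Notation LX := (freeLie K gvar).
Local Notation LY := (freeLie K nat).

Definition y_ (i : nat) : LX := gen K (Yvar i).
Definition z_ (i : nat) : LX := gen K (Zvar i).

Definition LX_comp : 'Z_2 -> set LX := fl_comp gvar_deg.

(* The canonical inclusion of L(Y) in L(Z u Y). *)
Definition LY_incl : LY -> LX := fl_lift y_.

Definition e_deg (i j : 'I_3) : 'Z_2 := if (i.+1 == j)%N then 1 else 0.

(* Entries below the diagonal vanish anyway, so [e_deg] is only relevant for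
   i <= j; component [g] is the span of the e_ij of degree [g]. *)
Definition gamma11 (g : 'Z_2) : set (UT K 3) :=
  [set A | forall i j : 'I_3, (i <= j)%N -> e_deg i j != g ->
             ut_val A i j = 0].

Definition Id_UT2 : set LY :=
  [set f | forall phi : LY -> UT K 2, lie_morphism phi -> phi f = 0].

Definition Id_gamma11 : set LX := graded_Id LX_comp gamma11.

Definition gamma11_generators : set LX :=
  [set lcomm (z_ 0) [:: z_ 1; z_ 2]]
  `|` [set lcomm (y_ 0) [:: y_ 1; z_ 0]]
  `|` LY_incl @` Id_UT2
  `|` [set f | exists q, ([set: K] #= `I_q)%card /\
               f = lcomm (z_ 0) (nseq q (y_ 0)) - lcomm (z_ 0) [:: y_ 0]].

(* m < |K|, which is no condition if K is infinite *)
Definition lt_card (m : nat) :=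
  forall q, ([set: K] #= `I_q)%card -> (m < q)%N.

(* Counting from 1: [z_i, y_1^(p_1), ..., y_r^(p_r)]. *)
Definition zy_comm (i r : nat) (p : r.-tuple nat) : LX :=
  lcomm (z_ i) (flatten [seq nseq (tnth p l) (y_ l) | l <- enum 'I_r]).

Definition zy_polys : set LX :=
  [set f | exists (i r : nat) (p : r.-tuple nat),
     (forall l, lt_card (tnth p l)) /\ f = zy_comm i p].

(* [r.-tuplelexi nat] is [r.-tuple nat] with the lexicographic order. *)
Definition zyzy_polys : set LX :=
  [set f | exists (i j r : nat) (p q : r.-tuplelexi nat),
     [/\ (i <= j)%N,
         forall l, lt_card (tnth p l) /\ lt_card (tnth q l),
         i = j -> (p < q)%O
       & f = lie_br (zy_comm i p) (zy_comm j q)]].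

End Gamma11.

Arguments LX_comp : clear implicits.
Arguments LY_incl : clear implicits.
Arguments gamma11 : clear implicits.
Arguments Id_UT2 : clear implicits.
Arguments Id_gamma11 : clear implicits.
Arguments gamma11_generators : clear implicits.
Arguments zy_polys : clear implicits.
Arguments zyzy_polys : clear implicits.

(* Main.v *)
Require Import Defs.
From mathcomp Require Import all_boot all_order all_algebra ring.
From mathcomp Require Import boolp classical_sets cardinality.

(* Modulo a T-ideal containing (i)-(iv), products of three odd elements vanish
   and even elements act on odd ones through commuting operators; hence every
   element is congruent to a combination of an element of L(Y), of commutators
   [z, y, ..., y] in which the y's may be sorted and their exponents reduced
   below |K|, and of brackets of two such commutators.

   Conversely, the substitutions y_l |-> diag(0, x_l, x_l + t_l) and
   z_i |-> a_i e_12 + b_i e_23 send [z_i, y^p] to a_i x^p e_12 + b_i t^p e_23,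
   kill L(Y) outside the diagonal, and send [[z_i, y^p], [z_j, y^q]] to
   (a_i b_j x^p t^q - a_j b_i x^q t^p) e_13. As the exponents are smaller than
   |K|, monomials are linearly independent functions, and suitable combinations
   of these evaluations form a dual system. What is left lies in L(Y), where
   the identities are those of UT_2. *)

Set Implicit Arguments.
Unset Strict Implicit.
Unset Printing Implicit Defensive.

Import Order.TTheory GRing.Theory.
Local Open Scope ring_scope.
Local Open Scope classical_set_scope.

(** * Subspaces and spans *)

Section Linear.
Variables (K : fieldType) (L : lmodType K).
Implicit Types (S A B : set L) (u v : L).

Definition subspace S := S 0 /\ forall a u v, S u -> S v -> S (a *: u + v).

Lemma subspaceD S u v : subspace S -> S u -> S v -> S (u + v).
Proof. by move=> [_ h] Su Sv; rewrite -[u]scale1r; apply: h. Qed.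

Lemma subspaceZ S a u : subspace S -> S u -> S (a *: u).
Proof. by move=> [h0 h] Su; rewrite -[_ *: _]addr0; apply: h. Qed.

Lemma subspaceN S u : subspace S -> S u -> S (- u).
Proof. by move=> hS Su; rewrite -scaleN1r; apply: subspaceZ. Qed.

Lemma subspaceB S u v : subspace S -> S u -> S v -> S (u - v).
Proof. by move=> hS Su Sv; apply: subspaceD => //; apply: subspaceN. Qed.

Lemma subspaceB_trans S u v w :
  subspace S -> S (u - v) -> S (v - w) -> S (u - w).
Proof.
by move=> hS huv hvw; rewrite -(subrK v u) -addrA; apply: subspaceD.
Qed.

Lemma subspace_sum S (I : Type) (r : seq I) (P : pred I) (F : I -> L) :
  subspace S -> (forall i, P i -> S (F i)) -> S (\sum_(i <- r | P i) F i).
Proof.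
move=> hS h; apply: big_ind => //; first by case: hS.
by move=> u v; apply: subspaceD.
Qed.

(** Linear combinations are built one term at a time, so that facts about spans go by induction. *)
Inductive lspan A : set L :=
  | lspan0 : lspan A 0
  | lspan_cons a u v : A u -> lspan A v -> lspan A (a *: u + v).

Lemma lspan_subspace A : subspace (lspan A).
Proof.
split=> [|a u v hu hv]; first exact: lspan0.
elim: hu => [|b w x Aw _ IH]; first by rewrite scaler0 add0r.
by rewrite scalerDr scalerA -addrA; apply: lspan_cons.
Qed.

Lemma mem_lspan A u : A u -> lspan A u.
Proof. by move=> /(@lspan_cons A 1 u 0)/(_ (lspan0 A));
  rewrite scale1r addr0. Qed.

Lemma lspan_least A S : subspace S -> A `<=` S -> lspan A `<=` S.
Proof.
move=> hS AS u; elim=> [|a v w /AS Sv _ Sw]; first by case: hS.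
by case: hS => _; apply.
Qed.

(** Repeated vectors are merged, because the independence arguments concern [uniq] sequences; terms
    in [S] go into the remainder. *)
Lemma lspan_mod A S f : subspace S -> lspan (A `|` S) f ->
  exists (s : seq L) (c : L -> K),
    [/\ uniq s, [set` s] `<=` A & S (f - \sum_(u <- s) c u *: u)].
Proof.
move=> hS; elim=> [|a u v [Au|Su] _ [s [c [us sA Sv]]]].
- exists [::], (fun=> 0); split=> //.
  by rewrite big_nil subr0; case: hS.
- pose s' := if u \in s then s else u :: s.
  (* [c] is cut to 0 outside [s], where its values are arbitrary, before [a] is added at [u]. *)
  exists s', (fun x =>
    (if x \in s then c x else 0) + (if x == u then a else 0)).
  have us' : uniq s' by rewrite /s'; case: ifPn => //= ->.
  split=> // [x|]; first by rewrite /s' /=; case: ifP => _;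
    [exact: sA | rewrite inE => /orP[/eqP->|/sA]].
  suff -> : \sum_(x <- s') ((if x \in s then c x else 0) +
    (if x == u then a else 0)) *: x
      = a *: u + \sum_(x <- s) c x *: x by rewrite opprD addrACA subrr add0r.
  under eq_bigr do rewrite scalerDl.
  rewrite big_split /= addrC; congr (_ + _).
    have us'' : u \in s' by rewrite /s'; case: ifP => // _; rewrite mem_head.
    rewrite (bigD1_seq u) //= eqxx big1 ?addr0 // => x /negPf->.
    by rewrite scale0r.
  rewrite /s'; case: ifPn => [_|uN]; last first.
    by rewrite big_cons (negPf uN) scale0r add0r big_seq [RHS]big_seq;
      apply: eq_bigr => x ->.
  by rewrite big_seq [RHS]big_seq; apply: eq_bigr => x ->.
- exists s, c; split=> //; rewrite -addrA.
  by case: hS => _; apply.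
Qed.

End Linear.

(** * Calculus in Lie algebras *)

Section LieAlgebras.
Variables (K : fieldType) (L : lieAlgType K).
Implicit Types (u v w : L) (I S A B : set L).

Lemma lie_br0l u : lie_br 0 u = 0.
Proof. by have := lie_brl (-1) 0 0 u; rewrite !scaleN1r !addNr. Qed.

Lemma lie_br0r u : lie_br u 0 = 0.
Proof. by have := lie_brr (-1) 0 0 u; rewrite !scaleN1r !addNr. Qed.

Lemma lie_brDl u v w : lie_br (u + v) w = lie_br u w + lie_br v w.
Proof. by have := lie_brl 1 u v w; rewrite !scale1r. Qed.

Lemma lie_brDr u v w : lie_br w (u + v) = lie_br w u + lie_br w v.
Proof. by have := lie_brr 1 u v w; rewrite !scale1r. Qed.

Lemma lie_brNl u w : lie_br (- u) w = - lie_br u w.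
Proof. by have := lie_brl (-1) u 0 w; rewrite !scaleN1r lie_br0l !addr0. Qed.

Lemma lie_brNr u w : lie_br w (- u) = - lie_br w u.
Proof. by have := lie_brr (-1) u 0 w; rewrite !scaleN1r lie_br0r !addr0. Qed.

Lemma lie_brC u v : lie_br u v = - lie_br v u.
Proof.
apply/eqP; rewrite -addr_eq0; apply/eqP.
by have := lie_brvv (u + v); rewrite lie_brDl !lie_brDr !lie_brvv add0r addr0.
Qed.

(** The Jacobi identity as a Leibniz rule: bracketing with [w] is a derivation. *)
Lemma lie_br_brl u v w :
  lie_br (lie_br u v) w = lie_br (lie_br u w) v + lie_br u (lie_br v w).
Proof.
have /eqP := lie_jacobi u v w; rewrite -addrA addr_eq0 => /eqP ->.
by rewrite (lie_brC (lie_br v w)) (lie_brC w u) lie_brNl opprD !opprK addrC.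
Qed.

Lemma lie_br_brr u v w :
  lie_br u (lie_br v w) = lie_br (lie_br u v) w - lie_br (lie_br u w) v.
Proof. by rewrite [in RHS]lie_br_brl addrAC subrr add0r. Qed.

Lemma lie_ideal_subspace I : lie_ideal I -> subspace I.
Proof. by case. Qed.

Lemma lspan_br A B S : subspace S ->
  (forall u v, A u -> B v -> S (lie_br u v)) ->
  forall u v, lspan A u -> lspan B v -> S (lie_br u v).
Proof.
move=> [S0 Sl] h u v hu hv; elim: hu => [|a x y Ax _ IH].
  by rewrite lie_br0l.
rewrite lie_brl; apply: (Sl) => //.
elim: hv => [|b z t Bz _ IH']; first by rewrite lie_br0r.
by rewrite lie_brr; apply: Sl => //; apply: h.
Qed.

Lemma lcomm_cat u s t : lcomm u (s ++ t) = lcomm (lcomm u s) t.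
Proof. exact: foldl_cat. Qed.

Lemma lcomm_rcons u s v : lcomm u (rcons s v) = lie_br (lcomm u s) v.
Proof. by rewrite -cats1 lcomm_cat. Qed.

Lemma lcomm_nseqS k u v :
  lcomm u (nseq k.+1 v) = lie_br (lcomm u (nseq k v)) v.
Proof. by rewrite -addn1 nseqD lcomm_cat. Qed.

Lemma lie_ideal_lcommB I u v s :
  lie_ideal I -> I (u - v) -> I (lcomm u s - lcomm v s).
Proof.
move=> [_ _ hI]; elim: s u v => //= x s IH u v huv; apply: IH.
by rewrite -lie_brNl -lie_brDl; case: (hI _ x huv).
Qed.

Lemma lie_ideal_brB I u u' v v' : lie_ideal I ->
  I (u - u') -> I (v - v') -> I (lie_br u v - lie_br u' v').
Proof.
move=> hI hu hv; have hS := lie_ideal_subspace hI; case: hI => _ _ hI.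
apply: (@subspaceB_trans _ _ _ _ (lie_br u' v)) => //.
  by rewrite -lie_brNl -lie_brDl; case: (hI _ v hu).
by rewrite -lie_brNr -lie_brDr; case: (hI _ u' hv).
Qed.

End LieAlgebras.

(** * Morphisms, gradings and T-ideals *)

Section Morphisms.
Variables (K : fieldType) (L M : lieAlgType K) (phi : L -> M).
Hypothesis phiM : lie_morphism phi.

Lemma lie_morphism0 : phi 0 = 0.
Proof.
by case: phiM => lin _; have := lin (-1) 0 0; rewrite !scaleN1r !addNr.
Qed.

Lemma lie_morphismD u v : phi (u + v) = phi u + phi v.
Proof. by case: phiM => lin _; have := lin 1 u v; rewrite !scale1r. Qed.

Lemma lie_morphismZ a u : phi (a *: u) = a *: phi u.
Proof. by case: phiM => lin _;
  rewrite -[a *: u]addr0 lin lie_morphism0 addr0. Qed.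

Lemma lie_morphismB u v : phi (u - v) = phi u - phi v.
Proof. by rewrite lie_morphismD -scaleN1r lie_morphismZ scaleN1r. Qed.

Lemma lie_morphism_sum (I : Type) (r : seq I) (c : I -> K) (F : I -> L) :
  phi (\sum_(i <- r) c i *: F i) = \sum_(i <- r) c i *: phi (F i).
Proof.
elim: r => [|i r IH]; first by rewrite !big_nil lie_morphism0.
by rewrite !big_cons lie_morphismD lie_morphismZ IH.
Qed.

Lemma lie_morphism_lcomm u s : phi (lcomm u s) = lcomm (phi u) (map phi s).
Proof.
elim/last_ind: s => [//|s v IH].
by rewrite map_rcons !lcomm_rcons -IH; case: phiM.
Qed.

End Morphisms.

Lemma lie_morphism_comp (K : fieldType) (L M N : lieAlgType K)
    (psi : M -> N) (phi : L -> M) :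
  lie_morphism psi -> lie_morphism phi -> lie_morphism (psi \o phi).
Proof.
move=> [psil psib] [phil phib].
by split=> [a u v|u v] /=; rewrite ?phil ?phib ?psil ?psib.
Qed.

(** Structural induction on a word representing [u]: a subalgebra containing the generators is
    everything. *)
Lemma freeLie_ind (K : fieldType) (V : Type) (S : set (freeLie K V)) :
  (forall x, S (gen K x)) -> subspace S ->
  (forall u v, S u -> S v -> S (lie_br u v)) -> forall u, S u.
Proof.
move=> hg hS hb u; rewrite -[u]fl_classK.
elim: (repr u) => [x||s IHs t IHt|a s IHs|s IHs t IHt].
- exact: hg.
- by case: hS.
- by rewrite -fl_addE; exact: (subspaceD hS IHs IHt).
- by rewrite -fl_scaleE; exact: (subspaceZ a hS IHs).
- by rewrite -fl_brE; exact: hb IHs IHt.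
Qed.

(** Degrees need checking on the variables only, since the components [fl_comp] are generated from
    them. *)
Lemma fl_lift_graded (K : fieldType) (V : Type) (deg : V -> 'Z_2)
    (M : lieAlgType K) (gM : 'Z_2 -> set M) (h : V -> M) :
  (forall x, gM (deg x) (h x)) -> (forall g, subspace (gM g)) ->
  (forall g k u v, gM g u -> gM k v -> gM (g + k) (lie_br u v)) ->
  graded_morphism (fl_comp deg) gM (fl_lift h).
Proof.
move=> hh hS hb; have hm := fl_lift_morphism h; split=> // g u.
elim=> {g u} [x|g|g a u v _ IHu _ IHv|g k u v _ IHu _ IHv].
- by rewrite fl_lift_gen.
- by rewrite (lie_morphism0 hm); case: (hS g).
- by case: (hS g) => _ hl; case: hm => -> _; apply: hl.
- by case: hm => _ ->; apply: hb.
Qed.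

Lemma fl_comp_subspace (K : fieldType) (V : Type) (deg : V -> 'Z_2) g :
  subspace (@fl_comp K V deg g).
Proof. by split=> [|a u v]; [apply: fl_comp0 | apply: fl_compP]. Qed.

Lemma graded_morphism_comp (K : fieldType) (L M N : lieAlgType K) gL gM gN
    (psi : M -> N) (phi : L -> M) :
  graded_morphism gM gN psi -> graded_morphism gL gM phi ->
  graded_morphism gL gN (psi \o phi).
Proof.
move=> [hpsi dpsi] [hphi dphi]; split; first exact: lie_morphism_comp.
by move=> g u /dphi /dpsi.
Qed.

(** A graded endomorphism followed by a graded evaluation is again a graded evaluation. *)
Lemma graded_Id_T_ideal (K : fieldType) (L M : lieAlgType K) gL gM :
  T_ideal gL (@graded_Id K L M gL gM).
Proof.
split; last first.
  by move=> phi hphi f hf psi hpsi; apply: (hf (psi \o phi));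
    apply: graded_morphism_comp hpsi hphi.
split.
- by move=> phi [hphi _]; exact: lie_morphism0.
- move=> a u v hu hv phi gphi; have [[lin _] _] := gphi.
  by rewrite lin hu // hv // scaler0 addr0.
- move=> u v hu; split=> phi gphi; have [[_ br] _] := gphi.
    by rewrite br hu // lie_br0l.
  by rewrite br hu // lie_br0r.
Qed.

(** Every clause passes to the intersection of the T-ideals containing [G]. *)
Lemma smallest_T_ideal (K : fieldType) (L : lieAlgType K) gL (G : set L) :
  T_ideal gL (smallest (T_ideal gL) G).
Proof.
split; last by move=> phi hphi f hf J [hJ GJ]; case: (hJ) => _ hp;
  apply: hp => //; apply: hf.
split.
- by move=> J [[[J0 _ _] _] _].
- move=> a u v hu hv J hJ; have [[[_ hl _] _] _] := hJ.
  by apply: hl; [apply: hu | apply: hv].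
- move=> u v hu; split=> J hJ; have [[[_ _ hb] _] _] := hJ.
    by have [] := hb u v (hu _ hJ).
  by have [] := hb u v (hu _ hJ).
Qed.

(** * Evaluations in UT_3 *)

Section UpperTriangularEntries.
Variables (K : fieldType) (n : nat).
Implicit Types (A B : UT K n).

Lemma ut_below A (i j : 'I_n) : (j < i)%N -> ut_val A i j = 0.
Proof. by case: A => A /= /upper_mxP; apply. Qed.

Lemma ut_eqP A B :
  (forall i j : 'I_n, (i <= j)%N -> ut_val A i j = ut_val B i j) -> A = B.
Proof.
move=> h; apply: val_inj; apply/matrixP => i j /=.
by case: (leqP i j) => ij; [exact: h | rewrite !ut_below].
Qed.

Lemma ut0E (i j : 'I_n) : ut_val (0 : UT K n) i j = 0.
Proof. by rewrite mxE. Qed.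

Lemma ut_linE a A B (i j : 'I_n) :
  ut_val (a *: A + B) i j = a * ut_val A i j + ut_val B i j.
Proof. by rewrite /= !mxE. Qed.

Lemma ut_brE A B (i j : 'I_n) :
  ut_val (lie_br A B) i j
  = \sum_k (ut_val A i k * ut_val B k j - ut_val B i k * ut_val A k j).
Proof. by rewrite sumrB /= !mxE. Qed.

Lemma ut_of_subproof (f : nat -> nat -> K) :
  \matrix_(i, j) (if (i <= j)%N then f i j else 0) \in @upper_mx K n.
Proof. by apply/upper_mxP => i j ji; rewrite mxE leqNgt ji. Qed.

(** Cutting [f] to 0 below the diagonal allows any function on pairs of natural numbers, given by
    pattern matching. *)
Definition ut_of (f : nat -> nat -> K) : UT K n := MkUT (ut_of_subproof f).

Lemma ut_ofE f (i j : 'I_n) : (i <= j)%N -> ut_val (ut_of f) i j = f i j.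
Proof. by move=> ij; rewrite /= mxE ij. Qed.

End UpperTriangularEntries.

Local Notation "''0_' n" := (@Ordinal n 0 isT) (at level 8).
Local Notation "''1_' n" := (@Ordinal n 1 isT) (at level 8).
Local Notation "''2_' n" := (@Ordinal n 2 isT) (at level 8).

(** * The grading on UT_3 and its even component *)

Section UT3.
Variable K : fieldType.
Implicit Types (A B : UT K 3).

Lemma I3_ind (P : 'I_3 -> Prop) : P '0_3 -> P '1_3 -> P '2_3 -> forall i, P i.
Proof.
move=> P0 P1 P2 [[|[|[|i]]] hi] //; first by rewrite (bool_irrelevance hi isT).
  by rewrite (bool_irrelevance hi isT).
by rewrite (bool_irrelevance hi isT).
Qed.

Lemma I2_ind (P : 'I_2 -> Prop) : P '0_2 -> P '1_2 -> forall i, P i.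
Proof.
move=> P0 P1 [[|[|i]] hi] //; first by rewrite (bool_irrelevance hi isT).
by rewrite (bool_irrelevance hi isT).
Qed.

Lemma sum_I3 (F : 'I_3 -> K) : \sum_i F i = F '0_3 + F '1_3 + F '2_3.
Proof.
rewrite !big_ord_recr big_ord0 /= add0r.
by congr (F _ + F _ + F _); apply: val_inj.
Qed.

Lemma sum_I2 (F : 'I_2 -> K) : \sum_i F i = F '0_2 + F '1_2.
Proof.
by rewrite !big_ord_recr big_ord0 /= add0r; congr (F _ + F _); apply: val_inj.
Qed.

Lemma ut2_brE (A B : UT K 2) :
  (ut_val (lie_br A B) '0_2 '0_2 = 0) * (ut_val (lie_br A B) '1_2 '1_2 = 0) *
  (ut_val (lie_br A B) '0_2 '1_2 =
     (ut_val A '0_2 '0_2 - ut_val A '1_2 '1_2) * ut_val B '0_2 '1_2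
   - (ut_val B '0_2 '0_2 - ut_val B '1_2 '1_2) * ut_val A '0_2 '1_2).
Proof.
have bl (C : UT K 2) : ut_val C '1_2 '0_2 = 0 by exact: ut_below.
by do ![split]; rewrite ut_brE sum_I2 ?bl; ring.
Qed.

Lemma ut3_brE A B :
  (ut_val (lie_br A B) '0_3 '0_3 = 0) * (ut_val (lie_br A B) '1_3 '1_3 = 0) *
  (ut_val (lie_br A B) '2_3 '2_3 = 0) *
  (ut_val (lie_br A B) '0_3 '1_3 =
     (ut_val A '0_3 '0_3 - ut_val A '1_3 '1_3) * ut_val B '0_3 '1_3
   - (ut_val B '0_3 '0_3 - ut_val B '1_3 '1_3) * ut_val A '0_3 '1_3) *
  (ut_val (lie_br A B) '1_3 '2_3 =
     (ut_val A '1_3 '1_3 - ut_val A '2_3 '2_3) * ut_val B '1_3 '2_3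
   - (ut_val B '1_3 '1_3 - ut_val B '2_3 '2_3) * ut_val A '1_3 '2_3) *
  (ut_val (lie_br A B) '0_3 '2_3 =
     (ut_val A '0_3 '0_3 - ut_val A '2_3 '2_3) * ut_val B '0_3 '2_3
   - (ut_val B '0_3 '0_3 - ut_val B '2_3 '2_3) * ut_val A '0_3 '2_3
   + (ut_val A '0_3 '1_3 * ut_val B '1_3 '2_3
      - ut_val B '0_3 '1_3 * ut_val A '1_3 '2_3)).
Proof.
have b10 (C : UT K 3) : ut_val C '1_3 '0_3 = 0 by exact: ut_below.
have b20 (C : UT K 3) : ut_val C '2_3 '0_3 = 0 by exact: ut_below.
have b21 (C : UT K 3) : ut_val C '2_3 '1_3 = 0 by exact: ut_below.
by do ![split]; rewrite ut_brE sum_I3 ?(b10, b20, b21); ring.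
Qed.

Lemma gamma11_subspace g : subspace (gamma11 K g).
Proof.
split=> [|a A B hA hB] i j ij hg; first by rewrite ut0E.
by rewrite ut_linE hA // hB // mulr0 addr0.
Qed.

Lemma gamma11_0P A :
  gamma11 K 0 A <-> ut_val A '0_3 '1_3 = 0 /\ ut_val A '1_3 '2_3 = 0.
Proof.
split=> [h|[h1 h2]]; first by split; apply: h.
by elim/I3_ind; elim/I3_ind.
Qed.

Lemma gamma11_1P A :
  gamma11 K 1 A <-> [/\ ut_val A '0_3 '0_3 = 0, ut_val A '1_3 '1_3 = 0,
                       ut_val A '2_3 '2_3 = 0 & ut_val A '0_3 '2_3 = 0].
Proof.
split=> [h|[h1 h2 h3 h4]]; first by split; apply: h.
by elim/I3_ind; elim/I3_ind.
Qed.

Lemma Z2_ind (P : 'Z_2 -> Prop) : P 0 -> P 1 -> forall g, P g.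
Proof.
move=> P0 P1; elim/I2_ind.
  by rewrite (_ : '0_2 = 0) //; apply: val_inj.
by rewrite (_ : '1_2 = 1) //; apply: val_inj.
Qed.

Lemma gamma11_br g k A B :
  gamma11 K g A -> gamma11 K k B -> gamma11 K (g + k) (lie_br A B).
Proof.
elim/Z2_ind: g; elim/Z2_ind: k.
- move=> /gamma11_0P[a1 a2] /gamma11_0P[b1 b2]; rewrite addr0.
  apply/gamma11_0P; rewrite !ut3_brE ?(a1, a2, b1, b2).
  by split; ring.
- move=> /gamma11_0P[a1 a2] /gamma11_1P[b1 b2 b3 b4]; rewrite add0r.
  apply/gamma11_1P; rewrite !ut3_brE ?(a1, a2, b1, b2, b3, b4).
  by split; ring.
- move=> /gamma11_1P[b1 b2 b3 b4] /gamma11_0P[a1 a2]; rewrite addr0.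
  apply/gamma11_1P; rewrite !ut3_brE ?(a1, a2, b1, b2, b3, b4).
  by split; ring.
move=> /gamma11_1P[a1 a2 a3 a4] /gamma11_1P[b1 b2 b3 b4].
rewrite (_ : 1 + 1 = 0 :> 'Z_2); last exact: val_inj.
apply/gamma11_0P; rewrite !ut3_brE ?(a1, a2, a3, a4, b1, b2, b3, b4).
by split; ring.
Qed.

Lemma gamma11_lift_graded (h : gvar -> UT K 3) :
  (forall x, gamma11 K (gvar_deg x) (h x)) ->
  graded_morphism (LX_comp K) (gamma11 K) (fl_lift h).
Proof.
by move=> hh; apply: fl_lift_graded hh gamma11_subspace gamma11_br.
Qed.

Lemma LY_incl_morphism : lie_morphism (LY_incl K).
Proof. exact: fl_lift_morphism. Qed.

Lemma LY_incl_even g : LX_comp K 0 (LY_incl K g).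
Proof.
move: g; apply: (@freeLie_ind K nat (LY_incl K @^-1` LX_comp K 0)) =>
  [i||u v hu hv] /=.
- by rewrite /LY_incl fl_lift_gen; exact: (@fl_comp_gen _ _ gvar_deg (Yvar i)).
- have S := @fl_comp_subspace K _ gvar_deg 0.
  split; first by rewrite /= (lie_morphism0 LY_incl_morphism); case: S.
  move=> /= a u v hu hv; case: LY_incl_morphism => -> _.
  by case: S => _; apply.
- case: LY_incl_morphism => _ ->.
  by have := fl_comp_br hu hv; rewrite addr0.
Qed.

(* The even component of [UT_3] is the direct sum of the copy of [UT_2] on the
   rows and columns 1, 3 and of the central line spanned by [e_22]. *)
Definition ut3_corner A : UT K 2 :=
  ut_of 2 (fun i j => ut_val A (if i is 0 then '0_3 else '2_3)
                             (if j is 0 then '0_3 else '2_3)).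
Definition ut3_middle A : UT K 2 :=
  ut_of 2 (fun i j =>
    if (i == 0%N) && (j == 0%N) then ut_val A '1_3 '1_3 else 0).

(** Meant for maps [r] that respect brackets on the even component only; this is enough because
    [phi] sends the image of L(Y) into it. *)
Lemma even_to_UT2 (phi : freeLie K gvar -> UT K 3) (r : UT K 3 -> UT K 2) :
  graded_morphism (LX_comp K) (gamma11 K) phi -> linear r ->
  (forall A B, gamma11 K 0 A -> gamma11 K 0 B ->
    r (lie_br A B) = lie_br (r A) (r B)) ->
  lie_morphism (r \o phi \o LY_incl K).
Proof.
move=> [[lin br] gr] rl rb; have [linY brY] := LY_incl_morphism.
split=> [a u v|u v] /=; first by rewrite linY lin rl.
by rewrite brY br rb //; apply/gr/LY_incl_even.
Qed.

(** The value of [f] is even, so its [e_12] and [e_23] entries vanish. Its corner and its middle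
    entry are evaluations of [f] in UT_2, hence 0, and they cover all other entries. *)
Lemma Id_UT2_sub (f : freeLie K nat) :
  Id_UT2 K f -> Id_gamma11 K (LY_incl K f).
Proof.
move=> hf phi gphi; have [_ gr] := gphi.
have [h01 h12] := (gamma11_0P _).1 (gr _ _ (LY_incl_even f)).
have corner : ut3_corner (phi (LY_incl K f)) = 0.
  apply: (hf (ut3_corner \o phi \o LY_incl K)); apply: even_to_UT2 => //.
    move=> a A B; apply: ut_eqP => i j ij.
    by rewrite ut_linE !ut_ofE // ut_linE.
  move=> A B /gamma11_0P[a1 a2] /gamma11_0P[b1 b2].
  apply: ut_eqP; elim/I2_ind; elim/I2_ind => // _.
  - by rewrite ut2_brE ut_ofE //= ut3_brE.
  - by rewrite ut2_brE !ut_ofE //= ut3_brE a1 b1; ring.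
  - by rewrite ut2_brE ut_ofE //= ut3_brE.
have middle : ut3_middle (phi (LY_incl K f)) = 0.
  apply: (hf (ut3_middle \o phi \o LY_incl K)); apply: even_to_UT2 => //.
    move=> a A B; apply: ut_eqP => i j ij.
    rewrite ut_linE !ut_ofE // ut_linE.
    by case: ifP => _ //; rewrite mulr0 addr0.
  move=> A B /gamma11_0P[a1 a2] /gamma11_0P[b1 b2].
  apply: ut_eqP; elim/I2_ind; elim/I2_ind => // _.
  - by rewrite ut2_brE ut_ofE //= ut3_brE.
  - by rewrite ut2_brE !ut_ofE //=; ring.
  - by rewrite ut2_brE ut_ofE.
have E2 (A : UT K 2) (i j : 'I_2) : A = 0 -> ut_val A i j = 0 by move=> ->;
  rewrite ut0E.
have := E2 _ '0_2 '0_2 corner; rewrite ut_ofE //= => h00.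
have := E2 _ '0_2 '1_2 corner; rewrite ut_ofE //= => h02.
have := E2 _ '1_2 '1_2 corner; rewrite ut_ofE //= => h22.
have := E2 _ '0_2 '0_2 middle; rewrite ut_ofE //= => h11.
by apply: ut_eqP; elim/I3_ind; elim/I3_ind => //; rewrite ut0E.
Qed.

(** A section of [ut3_corner] with even image, which turns ordinary evaluations in UT_2 into graded
    ones in UT_3. *)
Definition ut2_embed (A : UT K 2) : UT K 3 :=
  ut_of 3 (fun i j => if (i == 1%N) || (j == 1%N) then 0
                      else ut_val A (if i is 0 then '0_2 else '1_2)
                                    (if j is 0 then '0_2 else '1_2)).

Lemma ut2_embed_morphism : lie_morphism ut2_embed.
Proof.
split=> [a A B|A B]; apply: ut_eqP.
  move=> i j ij; rewrite ut_linE !ut_ofE //; case: ifP => _;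
    last by rewrite ut_linE.
  by rewrite mulr0 addr0.
elim/I3_ind; elim/I3_ind => // _;
  by rewrite ut3_brE !ut_ofE //= ?ut2_brE; ring.
Qed.

Lemma ut2_embed_inj (A : UT K 2) : ut2_embed A = 0 -> A = 0.
Proof.
move=> h; have E (i j : 'I_3) : ut_val (ut2_embed A) i j = 0 by rewrite h ut0E.
have := E '0_3 '0_3; rewrite ut_ofE //= => h00.
have := E '0_3 '2_3; rewrite ut_ofE //= => h02.
have := E '2_3 '2_3; rewrite ut_ofE //= => h22.
by apply: ut_eqP; elim/I2_ind; elim/I2_ind => //; rewrite ut0E.
Qed.

(** An evaluation in UT_2 followed by the injective [ut2_embed] extends to a graded evaluation in
    UT_3, where [f] vanishes. *)
Lemma LY_incl_Id (f : freeLie K nat) :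
  Id_gamma11 K (LY_incl K f) -> Id_UT2 K f.
Proof.
move=> hf phi hphi; apply: ut2_embed_inj.
(* The odd variables go to 0, which lies in every component. *)
pose h x := if x is Yvar i then ut2_embed (phi (gen K i)) else 0.
have gh : graded_morphism (LX_comp K) (gamma11 K) (fl_lift h).
  apply: gamma11_lift_graded => -[i|i] /=.
    by apply/gamma11_0P; rewrite !ut_ofE.
  by case: (gamma11_subspace 1).
rewrite -[RHS](hf _ gh).
rewrite -[LHS]/((ut2_embed \o phi) f) -[RHS]/((fl_lift h \o LY_incl K) f).
have hc : lie_morphism (fl_lift h \o LY_incl K).
  by apply: lie_morphism_comp LY_incl_morphism; apply: fl_lift_morphism.
(* Both sides are morphisms on L(Y) with the same values at the generators. *)
rewrite [RHS](fl_lift_unique (h := fun i => ut2_embed (phi (gen K i))) hc).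
  by apply: fl_lift_unique => //;
    apply: lie_morphism_comp ut2_embed_morphism hphi.
by move=> i /=; rewrite /LY_incl !fl_lift_gen.
Qed.

End UT3.

(** * Normal form modulo a T-ideal *)

Lemma perm_nseq_count (T : eqType) (x : T) (s : seq T) :
  perm_eq s (nseq (count_mem x s) x ++ filter (predC1 x) s).
Proof.
have <- : [seq y <- s | pred1 x y] = nseq (count_mem x s) x.
  by rewrite -size_filter; apply/all_pred1P/filter_all.
by rewrite perm_sym; apply/permEl/perm_filterC.
Qed.

Lemma card_uniq_seq (T : eqType) (s : seq T) :
  uniq s -> ([set` s] #= `I_(size s))%card.
Proof.
move=> us; apply/pcard_eqP/bijPex; exists (index^~ s); split.
- by move=> x /= xs; rewrite index_mem.
- move=> x y; rewrite !inE /= => xs ys e.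
  by rewrite -(nth_index x xs) e nth_index.
- case: s us => // x0 s us k ks.
  by exists (nth x0 (x0 :: s) k);
    [exact: mem_nth | exact: (index_uniq x0 ks us)].
Qed.

Lemma card_field_gt1 (K : fieldType) q : ([set: K] #= `I_q)%card -> (1 < q)%N.
Proof.
move=> Kq; have : uniq [:: 0; 1 : K] by rewrite /= inE eq_sym oner_eq0.
move=> /card_uniq_seq /card_eqPle[_ le2].
by rewrite -card_le_II -(card_le_eqr Kq) (card_le_trans le2) // subset_card_le.
Qed.

(** The hypothesis amounts to m <= |K|. Points are added one by one: a list of e < m distinct points
    exhausting K would give |K| = e, against [lt_card K e]. *)
Lemma lt_card_points (K : fieldType) m : (forall e, (e < m)%N -> lt_card K e) ->
  exists s : seq K, uniq s /\ size s = m.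
Proof.
elim: m => [_|m IH hm]; first by exists [::].
have [|s [us sm]] := IH; first by move=> e /ltnW/hm.
have [x xs] : exists x, x \notin s.
  apply: contrapT => /forallNP hx.
  have Ks : [set: K] = [set` s].
    by apply/seteqP; split=> // x _ /=; apply/negPn/negP/hx.
  by have := hm m (leqnn _) m;
    rewrite ltnn Ks -{1}sm card_uniq_seq // => /(_ isT).
by exists (x :: s); rewrite /= xs us sm.
Qed.

Section Expansion.
Variable K : fieldType.
Implicit Types (i j l r : nat) (s t : seq nat).

(** The [y]'s are listed by index in any order; sorting the list and counting repetitions leads to
    [zy_comm]. *)
Definition zs_comm i s : freeLie K gvar := lcomm (z_ K i) (map (y_ K) s).

Definition expseq r (p : r.-tuple nat) : seq nat :=
  flatten [seq nseq (tnth p k) (k : nat) | k <- enum 'I_r].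

Lemma zy_commE i r (p : r.-tuple nat) : zy_comm K i p = zs_comm i (expseq p).
Proof.
rewrite /zy_comm /zs_comm map_flatten -map_comp; congr (lcomm _ (flatten _)).
by apply: eq_map => l /=; rewrite map_nseq.
Qed.

Lemma zs_comm_rcons i s l :
  zs_comm i (rcons s l) = lie_br (zs_comm i s) (y_ K l).
Proof. by rewrite /zs_comm map_rcons lcomm_rcons. Qed.

Lemma zs_comm_odd i s : LX_comp K 1 (zs_comm i s).
Proof.
elim/last_ind: s => [|s l IH].
  exact: (@fl_comp_gen _ _ gvar_deg (Zvar i)).
rewrite zs_comm_rcons -[1]addr0; apply: fl_comp_br => //.
exact: (@fl_comp_gen _ _ gvar_deg (Yvar l)).
Qed.

Lemma count_expseq r (p : r.-tuple nat) l :
  count_mem l (expseq p) = nth 0%N p l.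
Proof.
rewrite count_flatten -map_comp sumnE big_map big_enum /=.
case: (ltnP l r) => lr; last first.
  rewrite nth_default ?size_tuple // big1 // => k _.
  by rewrite count_nseq /= ltn_eqF ?mul0n // (leq_trans (ltn_ord k)).
rewrite (bigD1 (Ordinal lr)) //= count_nseq /= eqxx mul1n big1 ?addn0 => [|k].
  by rewrite (tnth_nth 0%N).
by rewrite -val_eqE count_nseq /= => /negPf ->.
Qed.

Lemma expseq_tuple s r : (forall l, l \in s -> (l < r)%N) ->
  perm_eq s (expseq [tuple count_mem (k : nat) s | k < r]).
Proof.
move=> sr; apply/allP => l _; rewrite /= count_expseq; apply/eqP.
case: (ltnP l r) => lr; last first.
  rewrite nth_default ?size_tuple //; apply/count_memPn.
  by apply/negP => /sr; rewrite ltnNge lr.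
by rewrite -[l]/(val (Ordinal lr)) -tnth_nth tnth_mktuple.
Qed.

(** * Rewriting modulo a T-ideal containing the generators *)

Section ModuloTIdeal.
Variable J : set (freeLie K gvar).
Hypotheses (TJ : T_ideal (LX_comp K) J) (GJ : gamma11_generators K `<=` J).

Let Jideal : lie_ideal J. Proof. by case: TJ. Qed.
Let Jsub : subspace J. Proof. exact: lie_ideal_subspace. Qed.

(** The generators are written in fixed variables; substituting homogeneous elements of the right
    degrees is a graded endomorphism, under which [J] is stable. *)
Lemma T_ideal_subst (fz fy : nat -> freeLie K gvar) f :
  (forall i, LX_comp K 1 (fz i)) -> (forall i, LX_comp K 0 (fy i)) -> J f ->
  J (fl_lift (fun x => match x with Yvar i => fy i | Zvar i => fz i end) f).
Proof.
move=> hz hy Jf; case: TJ => _; apply=> //.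
apply: fl_lift_graded => [[i|i]|g|g k u v] //; first exact: fl_comp_subspace.
exact: fl_comp_br.
Qed.

Let even_y i : LX_comp K 0 (y_ K i).
Proof. exact: (@fl_comp_gen _ _ gvar_deg (Yvar i)). Qed.

Lemma odd3_mem u v w : LX_comp K 1 u -> LX_comp K 1 v -> LX_comp K 1 w ->
  J (lie_br (lie_br u v) w).
Proof.
move=> hu hv hw.
(* [z_0], [z_1], [z_2] go to [u], [v], [w]; later variables only need some odd value. *)
pose fz i := if i is 0 then u else if i is 1 then v else w.
have hz i : LX_comp K 1 (fz i) by case: i => [|[|i]].
have := T_ideal_subst hz even_y (GJ (or_introl (or_introl (or_introl erefl)))).
by rewrite (lie_morphism_lcomm (fl_lift_morphism _)) /= !fl_lift_gen.
Qed.

Lemma even2_odd_mem u v w : LX_comp K 0 u -> LX_comp K 0 v -> LX_comp K 1 w ->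
  J (lie_br (lie_br u v) w).
Proof.
move=> hu hv hw; pose fy i := if i is 0 then u else v.
have hy i : LX_comp K 0 (fy i) by case: i.
have := T_ideal_subst (fun=> hw) hy (GJ (or_introl (or_introl
  (or_intror erefl)))).
by rewrite (lie_morphism_lcomm (fl_lift_morphism _)) /= !fl_lift_gen.
Qed.

Lemma power_mem q w l : ([set: K] #= `I_q)%card -> LX_comp K 1 w ->
  J (lcomm w (nseq q (y_ K l)) - lcomm w [:: y_ K l]).
Proof.
move=> Kq hw.
have g : gamma11_generators K
    (lcomm (z_ K 0) (nseq q (y_ K 0)) - lcomm (z_ K 0) [:: y_ K 0]).
  by right; exists q.
have := T_ideal_subst (fun=> hw) (fun=> even_y l) (GJ g).
have m := fl_lift_morphism
  (fun x => match x with Yvar i => y_ K l | Zvar i => w end).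
by rewrite (lie_morphismB m) !(lie_morphism_lcomm m) map_nseq /= !fl_lift_gen.
Qed.

(** By Jacobi, [w, a, b] - [w, b, a] = [w, [a, b]], which up to sign is an instance of (ii). *)
Lemma lcomm_swap_mem w a b s : LX_comp K 1 w ->
  J (lcomm w (map (y_ K) [:: a, b & s]) - lcomm w (map (y_ K) [:: b, a & s])).
Proof.
move=> hw /=; apply: lie_ideal_lcommB => //.
rewrite -lie_br_brr lie_brC; apply: subspaceN => //.
exact: even2_odd_mem.
Qed.

Let odd_y w l : LX_comp K 1 w -> LX_comp K 1 (lie_br w (y_ K l)).
Proof. by move=> hw; have := fl_comp_br hw (even_y l); rewrite addr0. Qed.

Let J0 u : J (u - u). Proof. by rewrite subrr; case: Jsub. Qed.

Lemma lcomm_front_mem w s a t : LX_comp K 1 w ->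
  J (lcomm w (map (y_ K) (s ++ a :: t)) - lcomm w (map (y_ K) (a :: s ++ t))).
Proof.
elim: s w => [|b s IH] w hw; first exact: J0.
apply: (subspaceB_trans Jsub (IH _ (odd_y b hw))).
exact: lcomm_swap_mem.
Qed.

Lemma lcomm_perm_mem w s t : LX_comp K 1 w -> perm_eq s t ->
  J (lcomm w (map (y_ K) s) - lcomm w (map (y_ K) t)).
Proof.
elim: t s w => [|a t IH] s w hw; first by move=> /perm_nilP->; apply: J0.
move=> st; have sa : a \in s by rewrite (perm_mem st) mem_head.
case/splitPr: sa st => s1 s2 st.
apply: (subspaceB_trans Jsub (lcomm_front_mem _ _ _ hw)) => /=.
apply: IH; first exact: odd_y.
by move: st; rewrite -cat1s perm_catCA perm_cons.
Qed.

(** Induction on the length: if |K| = q and some index occurs at least q times, q copies are moved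
    to the front and replaced by one through (iv). *)
Lemma reduce_exponents w s : LX_comp K 1 w ->
  exists t, (forall l, lt_card K (count_mem l t)) /\
            J (lcomm w (map (y_ K) s) - lcomm w (map (y_ K) t)).
Proof.
move=> hw; have [n] := ubnP (size s); elim: n s => // n IH s sn.
have [h|/existsNP[l /existsNP[q /not_implyP[Kq /negP]]]] :=
  pselect (forall l, lt_card K (count_mem l s)); first by exists s.
rewrite -leqNgt => qs.
set k := (count_mem l s - q)%N.
set s' := nseq k l ++ filter (predC1 l) s.
have ss : perm_eq s (nseq q l ++ s').
  by rewrite catA -nseqD subnKC //; apply: perm_nseq_count.
(* This makes [l :: s'] shorter than [s], so that the induction advances. *)
have q1 : (1 < q)%N.
  apply: (card_field_gt1 Kq).
have [|t [ht Jt]] := IH (l :: s').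
  move: sn; rewrite (perm_size ss) size_cat size_nseq ltnS; apply: leq_trans.
  by rewrite -[(size _).+1]add2n leq_add2r.
exists t; split=> //; apply: subspaceB_trans Jt => //.
apply: subspaceB_trans (lcomm_perm_mem hw ss) _ => //.
rewrite map_cat map_nseq lcomm_cat -cat1s map_cat lcomm_cat.
by apply: lie_ideal_lcommB => //; apply: power_mem.
Qed.

(** All large [r] are allowed so that two commutators can later be given the same number of
    variables. *)
Lemma reduce_zs_comm i s : exists N, forall r, (N <= r)%N ->
  exists p : r.-tuple nat, (forall k, lt_card K (tnth p k)) /\
    J (zs_comm i s - zy_comm K i p).
Proof.
have [t [ht Jt]] := reduce_exponents s (zs_comm_odd i [::]).
exists (\max_(l <- t) l.+1) => r tr.
exists [tuple count_mem (k : nat) t | k < r]; split=> [l|].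
  by rewrite tnth_mktuple.
rewrite zy_commE; apply: (subspaceB_trans Jsub Jt).
apply: lcomm_perm_mem; first exact: (zs_comm_odd i [::]).
apply: expseq_tuple => l lt; apply: leq_trans tr.
by rewrite (big_rem l lt) leq_maxl.
Qed.

Definition zs_set : set (freeLie K gvar) :=
  [set f | exists i s, f = zs_comm i s].
Definition zszs_set : set (freeLie K gvar) :=
  [set f | exists u v, [/\ zs_set u, zs_set v & f = lie_br u v]].

Lemma zs_set_odd u : zs_set u -> LX_comp K 1 u.
Proof. by move=> [i [s ->]]; apply: zs_comm_odd. Qed.

Let mem_l A u : A u -> lspan (A `|` J) u.
Proof. by move=> ?; apply: mem_lspan; left. Qed.
Let mem_J A u : J u -> lspan (A `|` J) u.
Proof. by move=> ?; apply: mem_lspan; right. Qed.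
Let J_br u v : J u -> J (lie_br u v).
Proof. by case: Jideal => _ _ h Ju; case: (h _ v Ju). Qed.
Let br_J u v : J v -> J (lie_br u v).
Proof. by case: Jideal => _ _ h Ju; case: (h _ u Ju). Qed.

Lemma zs_zs_mem u v : lspan (zs_set `|` J) u -> lspan (zs_set `|` J) v ->
  lspan (zszs_set `|` J) (lie_br u v).
Proof.
apply: lspan_br; first exact: lspan_subspace.
move=> {}u {}v [zu|Ju]; last by move=> _; apply/mem_J/J_br.
by case=> [zv|Jv]; [apply: mem_l; exists u, v | apply/mem_J/br_J].
Qed.

(** Induction on [g], for all [u] at once: a bracket in L(Y) acts as the commutator of the two
    actions, and a single variable lengthens a commutator by one letter. *)
Lemma zs_LY_mem u g : lspan (zs_set `|` J) u ->
  lspan (zs_set `|` J) (lie_br u (LY_incl K g)).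
Proof.
have S := lspan_subspace (zs_set `|` J).
have [linY brY] := LY_incl_morphism K.
move: g u; apply: (@freeLie_ind K nat (fun g =>
  forall u, lspan (zs_set `|` J) u ->
  lspan (zs_set `|` J) (lie_br u (LY_incl K g)))) => [l u hu||g h hg hh u hu].
- apply: (lspan_br S _ hu (mem_lspan (erefl (LY_incl K (gen K l))))).
  move=> {hu}u _ [[i [s ->]]|Ju] <-; rewrite /LY_incl fl_lift_gen.
    by rewrite -zs_comm_rcons; apply: mem_l; exists i, (rcons s l).
  exact/mem_J/J_br.
- split=> [u _|a g h hg hh u hu].
    by rewrite (lie_morphism0 (LY_incl_morphism K)) lie_br0r; case: S.
  by rewrite linY lie_brr; case: S => _; apply; [apply: hg | apply: hh].
- by rewrite brY lie_br_brr; apply: subspaceB => //;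
  [apply/hh/hg | apply/hg/hh].
Qed.

Lemma zszs_LY_mem u g : zszs_set u ->
  lspan (zszs_set `|` J) (lie_br u (LY_incl K g)).
Proof.
move=> [a [b [ha hb ->]]]; rewrite lie_br_brl.
apply: subspaceD; first exact: lspan_subspace.
  by apply: zs_zs_mem; [apply: zs_LY_mem|]; apply: mem_l.
by apply: zs_zs_mem; [|apply: zs_LY_mem]; apply: mem_l.
Qed.

Lemma zszs_zs_mem u v : zszs_set u -> zs_set v -> J (lie_br u v).
Proof.
by move=> [a [b [ha hb ->]]] hv; apply: odd3_mem; apply: zs_set_odd.
Qed.

Lemma zszs_zszs_mem u v : zszs_set u -> zszs_set v -> J (lie_br u v).
Proof.
move=> hu [a [b [ha hb ->]]]; rewrite lie_br_brr.
by apply: subspaceB => //; apply: J_br; apply: zszs_zs_mem.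
Qed.

(** The span is closed under brackets by a multiplication table: L(Y) preserves [zs_set] and
    [zszs_set] up to spans and [J], two elements of [zs_set] give one of [zszs_set], and all longer
    products of odd elements fall into [J]. *)
Lemma freeLie_expand f :
  lspan (range (LY_incl K) `|` zs_set `|` zszs_set `|` J) f.
Proof.
set U := (X in lspan X); have S := lspan_subspace U.
have sub A u : A `<=` U -> lspan (A `|` J) u -> lspan U u.
  move=> AU; apply: lspan_least => // x [/AU|Jx]; first exact: mem_lspan.
  by apply: mem_lspan; right.
have subz := sub zs_set _ (fun _ h => or_introl (or_introl (or_intror h))).
have subzz := sub zszs_set _ (fun _ h => or_introl (or_intror h)).
have subJ u : J u -> lspan U u by move=> Ju; apply: mem_lspan; right.
have neg u v : lspan U (lie_br v u) -> lspan U (lie_br u v).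
  by move=> h; rewrite lie_brC; apply: subspaceN.
move: f; apply: (@freeLie_ind K gvar (lspan U)) => [[i|i]||u v hu hv].
- by apply: mem_lspan; do 3!left; exists (gen K i);
  rewrite // /LY_incl fl_lift_gen.
- by apply: mem_lspan; do 2!left; right; exists i, [::].
- exact: S.
apply: (lspan_br S _ hu hv) => {hu hv}{}u {}v.
have [_ brY] := LY_incl_morphism K.
case=> [[[[g _ <-]|zu]|zzu]|Ju]; last by move=> _; apply/subJ/J_br.
- case=> [[[[h _ <-]|zv]|zzv]|Jv]; last by apply/subJ/br_J.
  + by apply: mem_lspan; do 3!left; exists (lie_br g h).
  + by apply/neg/subz/zs_LY_mem/mem_l.
  + by apply/neg/subzz/zszs_LY_mem.
- case=> [[[[h _ <-]|zv]|zzv]|Jv]; last by apply/subJ/br_J.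
  + exact/subz/zs_LY_mem/mem_l.
  + by apply: subzz; apply: zs_zs_mem; apply: mem_l.
  + by apply/neg/subJ/zszs_zs_mem.
- case=> [[[[h _ <-]|zv]|zzv]|Jv]; last by apply/subJ/br_J.
  + exact/subzz/zszs_LY_mem.
  + exact/subJ/zszs_zs_mem.
  + exact/subJ/zszs_zszs_mem.
Qed.

Lemma zs_reduce u : zs_set u -> lspan (zy_polys K `|` J) u.
Proof.
move=> [i [s ->]]; have [r /(_ r (leqnn r))[p [hp Jp]]] := reduce_zs_comm i s.
rewrite -(subrK (zy_comm K i p) (zs_comm i s)).
apply: subspaceD; [exact: lspan_subspace|exact: mem_J|].
by apply: mem_l; exists i, r, p.
Qed.

Lemma zszs_reduce u : zszs_set u -> lspan (zyzy_polys K `|` J) u.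
Proof.
have S := lspan_subspace (zyzy_polys K `|` J).
move=> [_ [_ [[i [s ->]] [j [t ->]] ->]]].
have [r1 h1] := reduce_zs_comm i s; have [r2 h2] := reduce_zs_comm j t.
pose r := maxn r1 r2.
have [p [hp Jp]] := h1 r (leq_maxl _ _);
  have [q [hq Jq]] := h2 r (leq_maxr _ _).
rewrite -(subrK (lie_br (zy_comm K i p) (zy_comm K j q)) (lie_br _ _)).
apply: (subspaceD S); first exact/mem_J/(lie_ideal_brB Jideal Jp Jq).
(* Antisymmetry puts the smaller index first, or for equal indices the lexicographically smaller
   tuple; equal factors bracket to 0. *)
have [ij|ji|ij] := ltngtP i j.
- by apply: mem_l; exists i, j, r, p, q; split=> // [|e];
  [exact: ltnW|move: ij; rewrite e ltnn].
- rewrite lie_brC; apply: (subspaceN S).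
  by apply: mem_l; exists j, i, r, q, p; split=> // [|e];
    [exact: ltnW|move: ji; rewrite e ltnn].
rewrite -ij.
have [pq|qp|->] := Order.TotalTheory.ltgtP (p : r.-tuplelexi nat) q.
- by apply: mem_l; exists i, i, r, p, q.
- rewrite lie_brC; apply: (subspaceN S).
  by apply: mem_l; exists i, i, r, q, p.
- by rewrite lie_brvv; case: S.
Qed.

Lemma freeLie_normal_form f :
  lspan (range (LY_incl K) `|` zy_polys K `|` zyzy_polys K `|` J) f.
Proof.
set U := (X in lspan X); have S := lspan_subspace U.
apply: (lspan_least S _ (freeLie_expand f)) => u.
have sub A : A `<=` U -> lspan (A `|` J) `<=` lspan U.
  move=> AU; apply: lspan_least => // x [/AU|Jx]; first exact: mem_lspan.
  by apply: mem_lspan; right.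
case=> [[[gu|/zs_reduce zu]|/zszs_reduce zzu]|Ju].
- by apply: mem_lspan; do 3!left.
- by apply: sub zu => x zx; do 2!left; right.
- by apply: sub zzu => x zx; left; right.
- by apply: mem_lspan; right.
Qed.

End ModuloTIdeal.
End Expansion.

(** * Independence *)

(** Distinct points have an invertible Vandermonde matrix; the weights are column [k] of its
    inverse. *)
Lemma power_dual (K : fieldType) m (x : 'I_m -> K) (k : 'I_m) : injective x ->
  exists v : 'I_m -> K, forall e, (e < m)%N ->
    \sum_j v j * x j ^+ e = (e == k)%:R.
Proof.
move=> xinj; pose V := Vandermonde m (\row_j x j).
have uV : V \in unitmx.
  rewrite unitmxE det_Vandermonde unitfE; apply/prodf_neq0 => i _.
  apply/prodf_neq0 => j ij; rewrite !mxE subr_eq0 (inj_eq xinj).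
  by rewrite -val_eqE /= gtn_eqF.
exists (fun j => invmx V j k) => e em.
have := congr1 (fun M : 'M_m => M (Ordinal em) k) (mulmxV uV).
rewrite !mxE -val_eqE /= => <-; apply: eq_bigr => j _.
by rewrite !mxE mulrC.
Qed.

(** The weights are products of one-variable weights from [power_dual], placed on a grid of m^n
    points. *)
Lemma monomial_dual (K : fieldType) n m (k : 'I_n -> nat) :
  (forall e, (e < m)%N -> lt_card K e) -> (forall l, (k l < m)%N) ->
  exists (T : finType) (v : T -> K) (x : T -> nat -> K),
    forall e : 'I_n -> nat, (forall l, (e l < m)%N) ->
    \sum_t v t * \prod_(l < n) x t l ^+ e l = [forall l, e l == k l]%:R.
Proof.
move=> /lt_card_points[s [us sm]] km.
have pinj : injective (fun j : 'I_m => s`_j).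
  by move=> i j /eqP; rewrite nth_uniq ?sm ?ltn_ord // => /eqP/val_inj.
have /choice[w wP] : forall l, exists v : 'I_m -> K, forall e, (e < m)%N ->
    \sum_j v j * s`_j ^+ e = (e == k l)%:R.
  by move=> l; exact: (power_dual (Ordinal (km l)) pinj).
(* A grid point gives each of the first [n] variables one of the [m] scalars in [s]; variables of
   index at least [n] get 0. *)
exists {ffun 'I_n -> 'I_m}, (fun f : {ffun 'I_n -> 'I_m} => \prod_l w l (f l)),
  (fun (f : {ffun 'I_n -> 'I_m}) (l : nat) =>
    if insub l is Some l' then s`_(f l') else 0) => e em.
under eq_bigr => f _.
  under [X in _ * X]eq_bigr do rewrite valK.
  rewrite -big_split /=.
  over.
(* The sum over the grid factors into one-variable sums. *)
rewrite -(bigA_distr_bigA (fun l j => w l j * s`_j ^+ e l)) /=.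
under eq_bigr do rewrite wP //.
case: forallP => [h|/existsNP[l /negP/negPf hl]];
  first by rewrite big1 // => l _; rewrite h.
by rewrite (bigD1 l) //= hl mul0r.
Qed.

(** * Evaluations separating the normal forms *)

Section Independence.
Variable K : fieldType.

(** Successive diagonal differences are [x l] and [y l] (the latter is the parameter t_l); they are
    the factors by which bracketing with the l-th even variable scales [e_12] and [e_23]. *)
Definition eval_var (a b x y : nat -> K) (v : gvar) : UT K 3 :=
  match v with
  | Yvar l => ut_of 3 (fun i j => if i == j then
      match i with 0 => 0 | 1 => x l | _ => x l + y l end else 0)
  | Zvar k => ut_of 3 (fun i j =>
      match i, j with 0, 1 => a k | 1, 2 => b k | _, _ => 0 end)
  end.

Definition eval (a b x y : nat -> K) := fl_lift (eval_var a b x y).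

Lemma eval_graded a b x y :
  graded_morphism (LX_comp K) (gamma11 K) (eval a b x y).
Proof.
apply: gamma11_lift_graded => -[l|k] /=.
  by apply/gamma11_0P; rewrite !ut_ofE.
by apply/gamma11_1P; rewrite !ut_ofE.
Qed.

Section Values.
Variables a b x y : nat -> K.
Local Notation phi := (eval a b x y).

Lemma eval_zs_comm i s :
  (ut_val (phi (zs_comm K i s)) '0_3 '1_3 = a i * \prod_(l <- s) x l) *
  (ut_val (phi (zs_comm K i s)) '1_3 '2_3 = b i * \prod_(l <- s) y l).
Proof.
have [_ br] := fl_lift_morphism (eval_var a b x y).
elim/last_ind: s => [|s l [IH1 IH2]].
  by rewrite /eval fl_lift_gen !ut_ofE // !big_nil !mulr1.
rewrite zs_comm_rcons /eval br fl_lift_gen -/(eval a b x y) !ut3_brE.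
rewrite !ut_ofE //= IH1 IH2 -!cats1 !big_cat !big_seq1 /=.
by split; ring.
Qed.

Lemma eval_zs_comm_odd i s : [/\ ut_val (phi (zs_comm K i s)) '0_3 '0_3 = 0,
  ut_val (phi (zs_comm K i s)) '1_3 '1_3 = 0,
  ut_val (phi (zs_comm K i s)) '2_3 '2_3 = 0 &
  ut_val (phi (zs_comm K i s)) '0_3 '2_3 = 0].
Proof.
by apply/gamma11_1P; apply: (eval_graded a b x y).2; apply: zs_comm_odd.
Qed.

Lemma eval_zszs i s j t :
  let u := phi (lie_br (zs_comm K i s) (zs_comm K j t)) in
  (ut_val u '0_3 '1_3 = 0) *
  (ut_val u '0_3 '2_3 =
     a i * b j * (\prod_(l <- s) x l * \prod_(l <- t) y l)
   - a j * b i * (\prod_(l <- t) x l * \prod_(l <- s) y l)).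
Proof.
have [_ br] := fl_lift_morphism (eval_var a b x y).
rewrite /= /eval br -/(eval a b x y) !ut3_brE !eval_zs_comm.
have [-> -> -> ->] := eval_zs_comm_odd i s.
have [-> -> -> ->] := eval_zs_comm_odd j t.
by split; ring.
Qed.

(** Even variables become diagonal matrices; only the two entries read by the dual functionals are
    followed. *)
Lemma eval_LY g : (ut_val (phi (LY_incl K g)) '0_3 '1_3 = 0) *
  (ut_val (phi (LY_incl K g)) '0_3 '2_3 = 0).
Proof.
have [linY brY] := LY_incl_morphism K.
have [lin br] := fl_lift_morphism (eval_var a b x y).
have [] : ut_val (phi (LY_incl K g)) '0_3 '1_3 = 0 /\
          ut_val (phi (LY_incl K g)) '0_3 '2_3 = 0; last by [].
move: g; apply: (@freeLie_ind K nat (fun g => _ /\ _)) =>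
  [l||g h [g1 g2] [h1 h2]].
- by rewrite /LY_incl fl_lift_gen /eval fl_lift_gen !ut_ofE.
- split=> [|c g h [g1 g2] [h1 h2]].
    rewrite (lie_morphism0 (LY_incl_morphism K)) /eval (lie_morphism0
      (fl_lift_morphism _)).
    by rewrite !ut0E.
  by rewrite linY /eval lin !ut_linE -/(eval a b x y) g1 g2 h1 h2 mulr0 addr0.
- by rewrite brY /eval br -/(eval a b x y) !ut3_brE g1 g2 h1 h2; split; ring.
Qed.

End Values.

Lemma prod_expseq r (p : r.-tuple nat) (x : nat -> K) :
  \prod_(l <- expseq p) x l = \prod_(l < r) x l ^+ tnth p l.
Proof.
rewrite big_flatten big_map big_enum /=; apply: eq_bigr => l _.
by rewrite big_nseq iter_mulr_1.
Qed.

(** All tuples have the same length [n], since otherwise trailing zeros would give one polynomial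
    several names; [m] is the number of interpolation points. *)
Definition zy_bounded n m : set (freeLie K gvar) :=
  [set f | exists i (p : n.-tuple nat),
     (forall l, (tnth p l < m)%N) /\ f = zy_comm K i p].
Definition zyzy_bounded n m : set (freeLie K gvar) :=
  [set f | exists i j (p q : n.-tuplelexi nat),
     [/\ (i <= j)%N, forall l, (tnth p l < m)%N /\ (tnth q l < m)%N,
         i = j -> (p < q)%O & f = lie_br (zy_comm K i p) (zy_comm K j q)]].

Section Dual.
Variables (T : finType) (w : T -> K) (a b : nat -> K) (x y : T -> nat -> K).
Variables (i j : 'I_3).

(** The shape of all functionals in the dual system: one matrix entry, summed over finitely many
    evaluations with weights [w]. *)
Definition eval_comb (f : freeLie K gvar) : K :=
  \sum_t w t * ut_val (eval a b (x t) (y t) f) i j.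

Lemma eval_comb_lin c f g :
  eval_comb (c *: f + g) = c * eval_comb f + eval_comb g.
Proof.
rewrite /eval_comb mulr_sumr -big_split /=; apply: eq_bigr => t _.
have [lin _] := fl_lift_morphism (eval_var a b (x t) (y t)).
by rewrite /eval lin ut_linE mulrDr mulrCA.
Qed.

Lemma eval_comb_Id f : Id_gamma11 K f -> eval_comb f = 0.
Proof.
move=> hf; rewrite /eval_comb big1 // => t _.
by rewrite (hf _ (eval_graded _ _ _ _)) ut0E mulr0.
Qed.

End Dual.

(** For a single commutator the [e_12] entry is read, with [a] the indicator of [i] and weights
    selecting the exponents [p]. For a bracket of two, the [e_13] entry is read, with [a], [b] the
    indicators of [i], [j] and weights selecting [p] in x and [q] in t. *)
Lemma polys_dual n m u : (forall e, (e < m)%N -> lt_card K e) ->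
  (zy_bounded n m `|` zyzy_bounded n m) u ->
  exists Phi : freeLie K gvar -> K,
  [/\ (forall c f g, Phi (c *: f + g) = c * Phi f + Phi g),
      (forall f, Id_gamma11 K f -> Phi f = 0),
      (forall g, Phi (LY_incl K g) = 0) &
      forall v, (zy_bounded n m `|` zyzy_bounded n m) v -> Phi v = (v == u)%:R].
Proof.
have delta (p q : n.-tuple nat) : [forall l, tnth p l == tnth q l] = (p == q).
  by apply/forallP/eqP => [h|-> //]; apply: eq_from_tnth => l; apply/eqP.
move=> hm [[i [p [pm ->]]]|[i [j [p [q [ij pqm pq ->]]]]]].
  have [T [w [x xP]]] := monomial_dual hm pm.
  have val i' (p' : n.-tuple nat) : (forall l, (tnth p' l < m)%N) ->
      eval_comb w (fun k => (k == i)%:R) (fun=> 0) x x '0_3 '1_3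
        (zy_comm K i' p')
      = ((i' == i) && (p' == p))%:R.
    move=> pm'; rewrite -mulnb natrM -delta -xP // mulr_sumr.
    apply: eq_bigr => t _.
    by rewrite zy_commE eval_zs_comm prod_expseq mulrCA.
  exists (eval_comb w (fun k => (k == i)%:R) (fun=> 0) x x '0_3 '1_3); split.
  - exact: eval_comb_lin.
  - exact: eval_comb_Id.
  - by move=> g; rewrite /eval_comb big1 // => t _; rewrite eval_LY mulr0.
  move=> v [[i' [p' [pm' ->]]]|[i' [j' [p' [q' [_ _ _ ->]]]]]].
    rewrite val //; case: (altP andP) => [[/eqP-> /eqP->]|h];
      first by rewrite eqxx.
    (* Equality in the free algebra is not equality of indices: if the elements agreed with
       different indices, [val] would give 0 = 1. *)
    rewrite (_ : _ == _ = false) //; apply/eqP => e.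
    have := val i p pm; rewrite -e val // !eqxx (negPf h).
    by move/eqP; rewrite eq_sym oner_eq0.
  have E : eval_comb w (fun k => (k == i)%:R) (fun=> 0) x x '0_3 '1_3
     (lie_br (zy_comm K i' p') (zy_comm K j' q')) = 0.
    by rewrite /eval_comb big1 // => t _; rewrite !zy_commE eval_zszs mulr0.
  rewrite E; case: eqP => // e.
  have := val i p pm; rewrite -e E !eqxx.
  by move/eqP; rewrite eq_sym oner_eq0.
have pm l : (tnth p l < m)%N by case: (pqm l).
have qm l : (tnth q l < m)%N by case: (pqm l).
have [T [w [x xP]]] := monomial_dual hm pm.
have [T' [w' [y yP]]] := monomial_dual hm qm.
(* The product of two grids lets x and t vary independently. *)
pose Phi := eval_comb (fun t : T * T' => w t.1 * w' t.2)
  (fun k => (k == i)%:R) (fun k => (k == j)%:R)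
  (fun t => x t.1) (fun t => y t.2) '0_3 '2_3.
have prod_dual (p' q' : n.-tuple nat) :
    (forall l, (tnth p' l < m)%N) -> (forall l, (tnth q' l < m)%N) ->
    \sum_(t : T * T') w t.1 * w' t.2 *
      (\prod_(l < n) x t.1 l ^+ tnth p' l * \prod_(l < n) y t.2 l ^+ tnth q' l)
    = ((p' == p) && (q' == q))%:R.
  move=> pm' qm'; rewrite -mulnb natrM -2!delta -xP // -yP // big_distrlr.
  by rewrite pair_bigA; apply: eq_bigr => t _; rewrite mulrACA.
have val i' j' (p' q' : n.-tuplelexi nat) : (i' <= j')%N ->
    (forall l, (tnth p' l < m)%N /\ (tnth q' l < m)%N) ->
    (i' = j' -> (p' < q')%O) ->
    Phi (lie_br (zy_comm K i' p') (zy_comm K j' q'))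
    = [&& i' == i, j' == j, p' == p :> n.-tuple nat &
         q' == q :> n.-tuple nat]%:R.
  move=> ij' pqm' pq'.
  have pm' l : (tnth p' l < m)%N by case: (pqm' l).
  have qm' l : (tnth q' l < m)%N by case: (pqm' l).
  have -> : Phi (lie_br (zy_comm K i' p') (zy_comm K j' q')) =
     (i' == i)%:R * (j' == j)%:R * ((p' == p :> n.-tuple nat) &&
       (q' == q :> n.-tuple nat))%:R
   - (j' == i)%:R * (i' == j)%:R * ((q' == p :> n.-tuple nat) &&
     (p' == q :> n.-tuple nat))%:R.
    rewrite -!prod_dual // !mulr_sumr -sumrB; apply: eq_bigr => t _.
    by rewrite !zy_commE eval_zszs !prod_expseq; ring.
  rewrite -!natrM !mulnb.
  suff -> : (j' == i) && (i' == j) && ((q' == p :> n.-tuple nat) &&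
    (p' == q :> n.-tuple nat)) = false.
    by rewrite subr0 -!andbA.
  (* The second term of the [e_13] entry survives only for the swapped indices and tuples. Then
     [i <= j] and [i' <= j'] force equal indices, and the tuples would satisfy both strict
     inequalities. *)
  apply/negP => /andP[/andP[/eqP ji /eqP ij2] /andP[/eqP qp /eqP pq2]].
  subst i j p q.
  have e : i' = j' by apply/eqP; rewrite eqn_leq ij' ij.
  by have := Order.POrderTheory.lt_trans (pq (esym e)) (pq' e);
    rewrite Order.POrderTheory.ltxx.
exists Phi; split.
- exact: eval_comb_lin.
- exact: eval_comb_Id.
- by move=> g; rewrite /Phi /eval_comb big1 // => t _; rewrite eval_LY mulr0.
move=> v [[i' [p' [pm' ->]]]|[i' [j' [p' [q' [ij' pqm' pq' ->]]]]]].
  (* A single commutator is odd, so its value has no [e_13] entry. *)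
  have E : Phi (zy_comm K i' p') = 0.
    rewrite /Phi /eval_comb big1 // => t _; rewrite zy_commE.
    have [_ _ _ ->] := eval_zs_comm_odd (fun k => (k == i)%:R)
      (fun k => (k == j)%:R) (x t.1) (y t.2) i' (expseq p').
    by rewrite mulr0.
  rewrite E; case: eqP => // e.
  have := val i j p q ij pqm pq; rewrite -e E !eqxx.
  by move/eqP; rewrite eq_sym oner_eq0.
rewrite val //; case: (altP and4P) => [[/eqP-> /eqP-> /eqP-> /eqP->]|h];
  first by rewrite eqxx.
rewrite (_ : _ == _ = false) //; apply/eqP => e.
have := val i j p q ij pqm pq; rewrite -e val // !eqxx (negPf h).
by move/eqP; rewrite eq_sym oner_eq0.
Qed.

(** The functional dual to [u] kills identities and the image of L(Y), leaving [c u]. *)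
Lemma bounded_independent n m g (s : seq (freeLie K gvar)) c :
  (forall e, (e < m)%N -> lt_card K e) -> uniq s ->
  [set` s] `<=` zy_bounded n m `|` zyzy_bounded n m ->
  Id_gamma11 K (LY_incl K g + \sum_(u <- s) c u *: u) ->
  forall u, u \in s -> c u = 0.
Proof.
move=> hm us sB hId u su.
have [Phi [lin vId vY vB]] := polys_dual hm (sB _ su).
have := vId _ hId; rewrite -[LY_incl K g]scale1r lin vY mulr0 add0r.
have -> : Phi (\sum_(v <- s) c v *: v) = \sum_(v <- s) c v * Phi v.
  have Phi0 : Phi 0 = 0 by have := lin (-1) 0 0;
    rewrite scaleN1r addNr mulN1r addNr.
  elim: (s) => [|v r IH]; first by rewrite !big_nil Phi0.
  by rewrite !big_cons lin IH.
rewrite (bigD1_seq u) //= vB; last exact: sB.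
rewrite eqxx mulr1 big1_seq ?addr0 // => v /andP[/negPf vu sv].
by rewrite vB ?vu ?mulr0 //; apply: sB.
Qed.

Lemma expseq_iota r (p : r.-tuple nat) :
  expseq p = flatten [seq nseq (nth 0%N p k) k | k <- iota 0 r].
Proof.
rewrite /expseq -val_enum_ord -map_comp; congr flatten.
by apply: eq_map => k /=; rewrite (tnth_nth 0%N).
Qed.

End Independence.

Arguments zy_bounded : clear implicits.
Arguments zyzy_bounded : clear implicits.

(** * The identities and a basis *)

Lemma lt_card_leq (K : fieldType) e e' :
  (e <= e')%N -> lt_card K e' -> lt_card K e.
Proof. by move=> le h q /h; apply: leq_ltn_trans. Qed.

Lemma lt_card0 (K : fieldType) : lt_card K 0.
Proof. by move=> q /card_field_gt1 /ltnW. Qed.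

Lemma lt_card_max (K : fieldType) e e' :
  lt_card K e -> lt_card K e' -> lt_card K (maxn e e').
Proof. by case: (leqP e e'). Qed.

(** For x != 0, multiplication by x permutes the nonzero elements; comparing their products gives
    x^(q-1) = 1. *)
Lemma expf_card_eq (K : fieldType) q (x : K) :
  ([set: K] #= `I_q)%card -> x ^+ q = x.
Proof.
move=> Kq; have /finite_seqP[s' Ks] : finite_set [set: K] by exists q.
pose s := undup s'.
have ss y : y \in s by rewrite mem_undup; have : [set: K] y by []; rewrite Ks.
have us : uniq s := undup_uniq s'.
have sq : size s = q.
  apply/(@card_eq_II (size s) q); rewrite -(card_eqr Kq) card_eq_sym.
  have -> : [set: K] = [set` s] by apply/seteqP; split=> y //= _.
  exact: card_uniq_seq.
have [->|x0] := eqVneq x 0.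
  by rewrite expr0n; case: q Kq {sq} => // /card_field_gt1.
have pr : perm_eq (map ( *%R x) (rem 0 s)) (rem 0 s).
  apply: uniq_perm; [|exact: rem_uniq|].
    by rewrite map_inj_uniq ?rem_uniq //; apply: mulfI.
  move=> y; rewrite mem_rem_uniq // inE /= ss andbT.
  apply/mapP/idP => [[z zs ->]|y0].
    by move: zs; rewrite mem_rem_uniq // inE /= => /andP[z0 _];
      rewrite mulf_neq0.
  exists (x^-1 * y); last by rewrite mulVKf.
  by rewrite mem_rem_uniq // inE /= ss andbT mulf_neq0 ?invr_neq0.
have := perm_big (op := *%R) (x := 1) _ pr (P := xpredT) (F := id).
rewrite big_map big_split /= big_const_seq count_predT iter_mulr_1 size_rem
  // sq.
set P := \prod_(i <- _) i => eP.
have P0 : P != 0.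
  rewrite /P prodf_seq_neq0; apply/allP => y.
  by rewrite mem_rem_uniq // inE /= => /andP[].
have /(mulIf P0) x1 : x ^+ q.-1 * P = 1 * P by rewrite mul1r.
by rewrite -[in LHS](prednK (ltnW (card_field_gt1 Kq))) exprS x1 mulr1.
Qed.

Section MainTheorem.
Variable K : fieldType.

(** * Common bounds for finite families *)

Lemma tuple_pad n r (p : r.-tuple nat) : (r <= n)%N ->
  exists p' : n.-tuple nat, tval p' = p ++ nseq (n - r) 0%N.
Proof.
move=> rn; have hs : size (p ++ nseq (n - r) 0%N) == n.
  by rewrite size_cat size_tuple size_nseq subnKC.
by exists (Tuple hs).
Qed.

Lemma zy_comm_pad i n r (p : r.-tuple nat) (p' : n.-tuple nat) :
  (r <= n)%N -> tval p' = p ++ nseq (n - r) 0%N ->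
  zy_comm K i p' = zy_comm K i p.
Proof.
move=> rn hp; rewrite !zy_commE !expseq_iota; congr zs_comm.
rewrite -[in iota 0 n](subnKC rn) iotaD map_cat flatten_cat add0n.
rewrite [X in _ ++ X](_ : _ = [::]) ?cats0.
  congr flatten; apply/eq_in_map => k; rewrite mem_iota add0n => /andP[_ kr].
  by rewrite hp nth_cat size_tuple kr.
apply/nilP; rewrite /nilp size_flatten sumnE !big_map big_seq big1 // => k.
rewrite mem_iota => /andP[rk _]; rewrite hp nth_cat size_tuple ltnNge rk /=.
by rewrite nth_nseq if_same.
Qed.

Lemma tuple_pad_bounded n r m (p : r.-tuple nat) (p' : n.-tuple nat) :
  tval p' = p ++ nseq (n - r) 0%N -> (forall l, (tnth p l <= m)%N) ->
  forall l, (tnth p' l <= m)%N.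
Proof.
move=> hp pm; have hm : all (fun e => e <= m)%N p by apply/all_tnthP.
suff /all_tnthP : all (fun e => e <= m)%N p' by [].
by rewrite hp all_cat hm all_nseq orbT.
Qed.

(** Padding with zeros keeps the strict order: for equal lengths the comparison is decided before
    the common tail. *)
Lemma seqlexi_cat (s t u : seqlexi nat) : size s = size t ->
  (s < t)%O -> ((s ++ u : seqlexi nat) < (t ++ u : seqlexi nat))%O.
Proof.
elim: s t => [|a s IH] [|b t] //= [st].
rewrite !Order.SeqLexiOrder.ltxi_cons => /andP[-> /implyP h] /=.
by apply/implyP => /h; apply: IH.
Qed.

Lemma tuplelexi_pad n r (p q : r.-tuplelexi nat) (p' q' : n.-tuplelexi nat) :
  tval p' = (p : seq nat) ++ nseq (n - r) 0%N ->
  tval q' = (q : seq nat) ++ nseq (n - r) 0%N -> (p < q)%O -> (p' < q')%O.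
Proof.
move=> hp hq pq;
  rewrite -[(p' < q')%O]/((tval p' : seqlexi nat) < tval q')%O hp hq.
by apply: seqlexi_cat => //; rewrite !size_tuple.
Qed.

Lemma bounded_mono n n' m m' : (n <= n')%N -> (m <= m')%N ->
  zy_bounded K n m.+1 `|` zyzy_bounded K n m.+1 `<=`
  zy_bounded K n' m'.+1 `|` zyzy_bounded K n' m'.+1.
Proof.
move=> nn mm f [[i [p [pm ->]]]|[i [j [p [q [ij pqm pq ->]]]]]].
  have [p' hp] := tuple_pad p nn; left; exists i, p'; split.
    by apply: tuple_pad_bounded hp _ => l; rewrite -ltnS (leq_trans (pm l)).
  by rewrite (zy_comm_pad _ nn hp).
have [p' hp] := tuple_pad p nn; have [q' hq] := tuple_pad q nn.
right; exists i, j, p', q'; split=> //.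
- move=> l; split.
    by apply: (tuple_pad_bounded hp) => k; rewrite -ltnS (leq_trans (pqm k).1).
  by apply: (tuple_pad_bounded hq) => k; rewrite -ltnS (leq_trans (pqm k).2).
- by move=> /pq; apply: tuplelexi_pad.
- by rewrite (zy_comm_pad _ nn hp) (zy_comm_pad _ nn hq).
Qed.

(** [m] is the largest exponent occurring, hence itself below |K|; the strict bound is therefore
    [m.+1]. *)
Lemma polys_bounded1 f : (zy_polys K `|` zyzy_polys K) f ->
  exists n m, lt_card K m /\ (zy_bounded K n m.+1 `|` zyzy_bounded K n m.+1) f.
Proof.
have max_lt r (p : r.-tuple nat) : (forall l, lt_card K (tnth p l)) ->
    lt_card K (\max_l tnth p l).
  (* The empty maximum is 0, which is below |K| as well. *)
  move=> hp; apply: big_ind => [||l _];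
    [exact: lt_card0 | exact: lt_card_max|exact: hp].
have le_max r (p : r.-tuple nat) l : (tnth p l <= \max_k tnth p k)%N.
  exact: (leq_bigmax (F := fun k => tnth p k)).
case=> [[i [r [p [hp ->]]]]|[i [j [r [p [q [ij hpq pq ->]]]]]]].
  exists r, (\max_l tnth p l); split; first exact: max_lt.
  by left; exists i, p; split=> // l; rewrite ltnS.
exists r, (maxn (\max_l tnth p l) (\max_l tnth q l)); split.
  by apply: lt_card_max; apply: max_lt => l; case: (hpq l).
by right; exists i, j, p, q; split=> // l; rewrite !ltnS !leq_max !le_max orbT.
Qed.

Lemma polys_bounded (s : seq (freeLie K gvar)) :
  [set` s] `<=` zy_polys K `|` zyzy_polys K ->
  exists n m, lt_card K m /\
    [set` s] `<=` zy_bounded K n m.+1 `|` zyzy_bounded K n m.+1.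
Proof.
elim: s => [_|f s IH sP]; first by exists 0%N, 0%N; split;
  first exact: lt_card0.
have [|n1 [m1 [hm1 h1]]] := IH.
  by move=> u us; apply: sP; rewrite /= inE us orbT.
have [|n2 [m2 [hm2 h2]]] := @polys_bounded1 f; first by apply: sP;
  rewrite /= mem_head.
exists (maxn n1 n2), (maxn m1 m2); split; first exact: lt_card_max.
move=> u /=; rewrite inE => /orP[/eqP->|us].
  by apply: bounded_mono h2; rewrite leq_maxr.
by apply: bounded_mono (h1 _ us); rewrite leq_maxl.
Qed.

Lemma polys_independent g (s : seq (freeLie K gvar)) c : uniq s ->
  [set` s] `<=` zy_polys K `|` zyzy_polys K ->
  Id_gamma11 K (LY_incl K g + \sum_(u <- s) c u *: u) ->
  forall u, u \in s -> c u = 0.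
Proof.
move=> us /polys_bounded[n [m [hm sB]]]; apply: bounded_independent us sB.
by move=> e; rewrite ltnS => em; apply: lt_card_leq hm.
Qed.

(** * The generators are identities *)

(** Such an [X] is a multiple of [e_13], which commutes with [e_12] and [e_23]. Values of [z_1, z_2]
    and [y_1, y_2] have this form, whence (i) and (ii). *)
Lemma e13_odd (X A : UT K 3) :
  [/\ ut_val X '0_3 '0_3 = 0, ut_val X '1_3 '1_3 = 0
    & ut_val X '2_3 '2_3 = 0] ->
  gamma11 K 0 X -> gamma11 K 1 A -> lie_br X A = 0.
Proof.
move=> [x0 x1 x2] /gamma11_0P[x01 x12] /gamma11_1P[a0 a1 a2 a02].
apply: ut_eqP; elim/I3_ind; elim/I3_ind => // _;
  rewrite ut3_brE ut0E ?(x0, x1, x2, x01, x12, a0, a1, a2, a02) //; ring.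
Qed.

Lemma generators_Id : gamma11_generators K `<=` Id_gamma11 K.
Proof.
have even_y i : LX_comp K 0 (y_ K i).
  exact: (@fl_comp_gen _ _ gvar_deg (Yvar i)).
have odd_z i : LX_comp K 1 (z_ K i) by exact: (@zs_comm_odd K i [::]).
move=> f [[[->|->]|[g hg <-]]|[q [Kq ->]]]; last 2 first.
- exact: Id_UT2_sub.
- move=> phi [hphi gr]; rewrite (lie_morphismB hphi) !(lie_morphism_lcomm hphi).
  rewrite map_nseq /=; set A := phi (z_ K 0); set Y := phi (y_ K 0).
  have hA : gamma11 K 1 A by apply/gr/odd_z.
  have hY : gamma11 K 0 Y by apply/gr/even_y.
  have odd_k k : gamma11 K 1 (lcomm A (nseq k Y)).
    elim: k => // k IH; rewrite lcomm_nseqS.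
    by have := gamma11_br IH hY; rewrite addr0.
  (* Bracketing with [Y] scales the [e_12] entry of an odd matrix by [c] and its [e_23] entry by
     [d], so (iv) reduces to c^q = c and d^q = d. *)
  pose c := ut_val Y '1_3 '1_3 - ut_val Y '0_3 '0_3.
  pose d := ut_val Y '2_3 '2_3 - ut_val Y '1_3 '1_3.
  have [y01 y12] := (gamma11_0P _).1 hY.
  have pow k :
      ut_val (lcomm A (nseq k Y)) '0_3 '1_3 = c ^+ k * ut_val A '0_3 '1_3
      /\ ut_val (lcomm A (nseq k Y)) '1_3 '2_3 = d ^+ k * ut_val A '1_3 '2_3.
    elim: k => [|k [IH1 IH2]]; first by rewrite !expr0 !mul1r.
    rewrite lcomm_nseqS !ut3_brE IH1 IH2 y01 y12 !exprS.
    by rewrite /c /d; split; ring.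
  suff -> : lcomm A (nseq q Y) = lcomm A (nseq 1 Y) by rewrite subrr.
  have [e1 e2] := pow q; have [f1 f2] := pow 1%N.
  have [g1 g2 g3 g4] := (gamma11_1P _).1 (odd_k q).
  have [h1 h2 h3 h4] := (gamma11_1P _).1 (odd_k 1%N).
  apply: ut_eqP; elim/I3_ind; elim/I3_ind => // _;
    rewrite ?(e1, e2, f1, f2, g1, g2, g3, g4, h1, h2, h3, h4) //;
    by rewrite (expf_card_eq _ Kq).
- move=> phi [hphi gr]; rewrite (lie_morphism_lcomm hphi) /=.
  apply: e13_odd; first by rewrite !ut3_brE.
    by have := gamma11_br (gr _ _ (odd_z 0%N)) (gr _ _ (odd_z 1%N)).
  by apply/gr/odd_z.
- move=> phi [hphi gr]; rewrite (lie_morphism_lcomm hphi) /=.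
  apply: e13_odd; first by rewrite !ut3_brE.
    by have := gamma11_br (gr _ _ (even_y 0%N)) (gr _ _ (even_y 1%N)).
  by apply/gr/odd_z.
Qed.

(** * Generation of the ideal and the basis *)

Lemma Id_gamma11_generated :
  Id_gamma11 K = smallest (T_ideal (LX_comp K)) (gamma11_generators K).
Proof.
set J := smallest _ _.
have TJ : T_ideal (LX_comp K) J := smallest_T_ideal _ _.
have GJ : gamma11_generators K `<=` J by exact: sub_gen_smallest.
have JI : J `<=` Id_gamma11 K.
  by apply: smallest_sub; [exact: graded_Id_T_ideal | exact: generators_Id].
have [Jideal _] := TJ; have Jsub := lie_ideal_subspace Jideal.
have [[Iideal _] LYM] :=
  (graded_Id_T_ideal (LX_comp K) (gamma11 K), LY_incl_morphism K).
have Isub := lie_ideal_subspace Iideal.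
apply/seteqP; split=> // f hf.
(* [S] is L(Y) + J: taking it as the modulus absorbs the whole L(Y)-part of the normal form into one
   element [g]. *)
pose S : set (freeLie K gvar) := [set u | exists g, J (u - LY_incl K g)].
have hS : subspace S.
  split=> [|a u v [g hg] [h hh]].
    by exists 0; rewrite (lie_morphism0 LYM) subr0; case: Jsub.
  exists (a *: g + h); have [-> _] := LYM.
  by rewrite opprD addrACA -scalerBr; case: Jsub => _; apply.
have /(lspan_mod hS)[s [c [us sP [g hg]]]] :
    lspan (zy_polys K `|` zyzy_polys K `|` S) f.
  apply: (lspan_least (lspan_subspace _) _ (freeLie_normal_form TJ GJ f)).
  move=> u [[[[g _ <-]|zu]|zzu]|Ju]; apply: mem_lspan.
  - by right; exists g; rewrite subrr; case: Jsub.
  - by left; left.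
  - by left; right.
  - by right; exists 0; rewrite (lie_morphism0 LYM) subr0.
have hI : Id_gamma11 K (LY_incl K g + \sum_(u <- s) c u *: u).
  have -> : LY_incl K g + \sum_(u <- s) c u *: u
      = f - (f - \sum_(u <- s) c u *: u - LY_incl K g).
    by rewrite -addrA -opprD opprB [RHS]addrC subrK addrC.
  exact: (subspaceB Isub hf (JI _ hg)).
have s0 : \sum_(u <- s) c u *: u = 0.
  by rewrite big1_seq // => u /andP[_ /(polys_independent us sP hI) ->];
    rewrite scale0r.
move: hg hI; rewrite s0 subr0 addr0 => hg /LY_incl_Id hI.
(* With the combination gone, [f] is [g] modulo [J], and [g] is an identity of UT_2, so its image is
   a generator of type (iii). *)
rewrite -(subrK (LY_incl K g) f); apply: (subspaceD Jsub hg).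
by apply: GJ; left; right; exists g.
Qed.

Lemma Id_gamma11_basis (B : set (freeLie K nat)) : basis_mod (Id_UT2 K) B ->
  basis_mod (Id_gamma11 K) (LY_incl K @` B `|` zy_polys K `|` zyzy_polys K).
Proof.
set A := _ `|` zyzy_polys K; move=> [Bspan Bindep].
have TI := graded_Id_T_ideal (LX_comp K) (gamma11 K); have [Iideal _] := TI.
have Isub := lie_ideal_subspace Iideal; have LYM := LY_incl_morphism K.
split=> [f|s c us sA hI].
  suff /(lspan_mod Isub)[s [c [_ sA hs]]] :
    lspan (A `|` Id_gamma11 K) f by exists s, c.
  (* The ideal of identities is itself a T-ideal containing the generators, so the normal form holds
     modulo it. *)
  apply: (lspan_least (lspan_subspace _) _
    (freeLie_normal_form TI generators_Id f)).
  move=> u [[[[g _ <-]|zu]|zzu]|Iu]; last 3 first.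
  - by apply: mem_lspan; left; left; right.
  - by apply: mem_lspan; left; right.
  - by apply: mem_lspan; right.
  have [s [c [sB hg]]] := Bspan g.
  rewrite -(subrK (\sum_(b <- s) c b *: b) g) (lie_morphismD LYM).
  apply: subspaceD; first exact: lspan_subspace.
    by apply: mem_lspan; right; apply: Id_UT2_sub.
  rewrite (lie_morphism_sum LYM) big_seq.
  apply: subspace_sum => [|b bs]; first exact: lspan_subspace.
  apply: subspaceZ; first exact: lspan_subspace.
  by apply: mem_lspan; left; left; left; exists b => //; apply: sB.
(* The family is split into commutator polynomials [s1] and the rest [s2], which must come from
   [B]. *)
pose a u := `[< (zy_polys K `|` zyzy_polys K) u >].
pose s1 := filter a s; pose s2 := filter (predC a) s.
(* Preimages in [B] are chosen on [s2]; elsewhere [beta] takes an arbitrary value. *)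
have /choice[beta betaP] :
  forall u, exists b, u \in s2 -> B b /\ LY_incl K b = u.
  move=> u; have [|_] := boolP (u \in s2); last by exists 0.
  rewrite mem_filter => /andP[/asboolPn nu /sA[[[b Bb <-]|zu]|zzu]].
  - by exists b.
  - by case: nu; left.
  - by case: nu; right.
pose g := \sum_(u <- s2) c u *: beta u.
have LYg : LY_incl K g = \sum_(u <- s2) c u *: u.
  rewrite (lie_morphism_sum LYM) big_seq [RHS]big_seq.
  by apply: eq_bigr => u us2; have [_ ->] := betaP u us2.
have hI' : Id_gamma11 K (LY_incl K g + \sum_(u <- s1) c u *: u).
  by move: hI; rewrite LYg (bigID a) addrC !big_filter.
have s1P : [set` s1] `<=` zy_polys K `|` zyzy_polys K.
  by move=> u /=; rewrite mem_filter => /andP[/asboolP].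
(* The coefficients on [s1] vanish first, as independence there holds modulo L(Y); the remaining
   relation can then be pulled back to L(Y). *)
have c1 : forall u, u \in s1 -> c u = 0.
  by apply: polys_independent s1P hI'; apply: filter_uniq.
have betaI : {in s2 &, injective beta}.
  move=> u v us2 vs2 e; have [_ <-] := betaP u us2; have [_ <-] := betaP v vs2.
  by rewrite e.
have hg : Id_UT2 K (\sum_(b <- map beta s2) c (LY_incl K b) *: b).
  rewrite big_map; apply: LY_incl_Id; rewrite (lie_morphism_sum LYM).
  have -> : \sum_(u <- s2) c (LY_incl K (beta u)) *:
      LY_incl K (beta u) = LY_incl K g.
    rewrite LYg big_seq [RHS]big_seq.
    by apply: eq_bigr => u us2; have [_ ->] := betaP u us2.
  move: hI'; rewrite [\sum_(u <- s1) _]big1_seq ?addr0 // => u /andP[_ /c1->].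
  by rewrite scale0r.
move=> u su; case au : (a u); first by apply: c1; rewrite mem_filter au.
have us2 : u \in s2 by rewrite mem_filter /= au.
have [_ {1}<-] := betaP u us2.
apply: (Bindep _ (fun b => c (LY_incl K b)) _ _ hg); last exact: map_f.
  by rewrite map_inj_in_uniq // filter_uniq.
by move=> _ /mapP[v vs2 ->]; have [] := betaP v vs2.
Qed.

End MainTheorem.

Theorem theorem3p22 (K : fieldType) :
  Id_gamma11 K = smallest (T_ideal (LX_comp K)) (gamma11_generators K) /\
  (forall B : set (freeLie K nat), basis_mod (Id_UT2 K) B ->
     basis_mod (Id_gamma11 K)
       (LY_incl K @` B `|` zy_polys K `|` zyzy_polys K)).
Proof.
split; first exact: Id_gamma11_generated.
exact: Id_gamma11_basis.
Qed.
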